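(* Let $(W,W',G,R)$ be an approximate Stein coupling with $W$ and $W'$ integer valued, $\mathbb{E}W=\mu$ and $\mathrm{Var}(W)=\sigma^2$ (with $0<\sigma^2<\infty$). Set $D:=W'-W$, and let $\mathcal{F}_1$ and $\mathcal{F}_2$ be sigma-algebras such that $W$ is $\mathcal{F}_1$-measurable and such that $(G,D)$ is $\mathcal{F}_2$-measurable. Define $$\Psi := \bigl|\mathbb{E}[GD\mid\mathcal{F}_1]-\mathbb{E}[GD]\bigr|,\qquad \Upsilon := \mathbb{E}\bigl[|GD(D-1)|\,S_2(\mathcal{L}(W\mid\mathcal{F}_2))\bigr].$$ Then $$d_{\mathrm{TV}}\bigl(\mathcal{L}(W),\mathrm{TP}(\mu,\sigma^2)\bigr)\le \frac{\mathbb{E}\Psi}{\sigma^2}+\frac{2\sqrt{\mathbb{E}R^2}}{\sigma}+\frac{2(\Upsilon+1)}{\sigma},$$ and $$\begin{aligned} d_{\mathrm{loc}}\bigl(\mathcal{L}(W),\mathrm{TP}(\mu,\sigma^2)\bigr)&\le \frac{\mathbb{E}\Psi}{\sigma^3\sqrt{2e}}+\frac{\mathbb{E}[\Psi|W-\mu|]}{\sigma^4}+\sup_{a\in\mathbb{Z}}\frac{\mathbb{E}\{\Psi\,\mathrm{I}[W=a]\}}{\sigma^2}\\ &\quad+\frac{\sqrt{\mathbb{E}R^2}}{\sigma^2}\Bigl(2+\frac1{\sqrt{2e}}+\sigma\sup_{a\in\mathbb{Z}}\mathbb{P}(W=a)\Bigr)+\frac{2(\Upsilon+1)}{\sigma^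2}.\end{aligned}$$
   Context: Random variables $(W,W',G,R)$ on a common probability space with $\mathbb{E}W=\mu$ form an approximate Stein coupling if $\mathbb{E}[G(f(W')-f(W))]=\mathbb{E}[(W-\mu)f(W)]+\mathbb{E}[Rf(W)]$ for all $f$ such that the expectations exist. It is understood that $GD$ is integrable. Smoothness measure: for the law of an integer valued random variable, $S_l(\mathcal{L}(W)):=\sup_{h:\mathbb{Z}\to\mathbb{R},\,\|h\|\le1}|\mathbb{E}\Delta^l h(W)|$, $l\ge1$, where $\Delta g(k):=g(k+1)-g(k)$ and $\|\cdot\|$ is the supremum norm. $\mathcal{L}(W\mid\mathcal{F})$ is the (random) conditional law of $W$ given $\mathcal{F}$, so $S_2(\mathcal{L}(W\mid\mathcal{F}_2))$ is a random variable. Translated Poisson distribution: $Z\sim\mathrm{TP}(\mu,\sigma^2)$ means that $Z-s$ has the Poisson distribution with mean $\sigma^2+\gamma$, where $s:=\lfloor\mu-\sigma^2\rfloor$ and $\gamma:=\mu-\sigma^2-\lfloor\mu-\sigma^2\rfloor$. Metrics for integer valued $X,Y$: $d_{\mathrm{TV}}(\mathcal{L}(X),\mathcal{L}(Y)):=\sup_{A\subseteq\mathbb{Z}}|\mathbb{P}[X\in A]-\mathbb{P}[Y\in A]|$ and $d_{\mathrm{loc}}(\mathcal{L}(X),\mathcal{L}(Y)):=\sup_{a\in\mathbb{Z}}|\mathbb{P}[X=a]-\mathbb{P}[Y=a]|$. $\mathrm{I}[\cdot]$ denotes an indicator. *)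

(* Defs.v *)
From HB Require Import structures.
From mathcomp Require Import all_boot all_order all_algebra.
From mathcomp Require Import all_classical all_reals all_analysis.

Set Implicit Arguments.
Unset Strict Implicit.
Unset Printing Implicit Defensive.

Import Order.TTheory GRing.Theory Num.Theory.

Local Open Scope classical_set_scope.
Local Open Scope ring_scope.

HB.instance Definition _ := isPointed.Build int 0.
HB.instance Definition _ := @isMeasurable.Build default_measure_display
  int discrete_measurable discrete_measurable0
  discrete_measurableC discrete_measurableU.

Definition is_sub_sigma_algebra d (T : measurableType d) (F : set (set T)) : Prop :=
  sigma_algebra setT F /\ F `<=` measurable.

Definition sub_measurable d d' (T : measurableType d) (U : measurableType d')
    (F : set (set T)) (X : T -> U) : Prop :=
  forall B : set U, measurable B -> F (X @^-1` B).

(* [Y] is a version of the conditional expectation of [X] given [F]. *)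
Definition cond_expectation d (T : measurableType d) (R : realType)
    (P : probability T R) (F : set (set T)) (X Y : T -> R) : Prop :=
  [/\ sub_measurable F Y,
      P.-integrable setT (EFin \o Y) &
      forall A : set T, F A ->
        (\int[P]_(w in A) (Y w)%:E = \int[P]_(w in A) (X w)%:E)%E].

(* [K] is a version of the (regular) conditional law of [W] given [F]: every
   [K w] is a probability measure on the integers, and [w |-> K w A] is a
   version of the conditional probability that [W] lies in [A]. *)
Definition cond_law d (T : measurableType d) (R : realType)
    (P : probability T R) (F : set (set T)) (W : T -> int)
    (K : T -> probability int R) : Prop :=
  forall A : set int,
    cond_expectation P F (\1_(W @^-1` A)) (fun w => fine (K w A)).

Definition forward_diff (R : realType) (g : int -> R) : int -> R :=
  fun k => g (k + 1) - g k.

(* Only meant for [0 < l]. *)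
Definition smoothness (R : realType) (l : nat) (p : probability int R) : \bar R :=
  ereal_sup [set (`| 'E_p[iter l (@forward_diff R) h] |)%E
            | h in [set h : int -> R | forall k, `|h k| <= 1]].

Definition dTV (R : realType) (p q : probability int R) : \bar R :=
  ereal_sup [set (`| p A - q A |)%E | A in [set: set int]].

Definition dloc (R : realType) (p q : probability int R) : \bar R :=
  ereal_sup [set (`| p [set a] - q [set a] |)%E | a in [set: int]].

Definition translate (s : int) (n : nat) : int := n%:Z + s.

Lemma measurable_translate (s : int) : measurable_fun setT (translate s).
Proof. by []. Qed.

HB.instance Definition _ (s : int) :=
  isMeasurableFun.Build _ _ _ _ (translate s) (measurable_translate s).

Definition tp_shift (R : realType) (mu sigma2 : R) : int :=
  Num.floor (mu - sigma2).

Definition tp_gamma (R : realType) (mu sigma2 : R) : R :=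
  mu - sigma2 - (Num.floor (mu - sigma2))%:~R.

(* The law of [N + s] for [N] Poisson with mean [sigma2 + gamma]. The last
   argument of the library's [poisson_prob] is a dummy. *)
Definition translated_poisson (R : realType) (mu sigma2 : R) : probability int R :=
  distribution (poisson_prob (sigma2 + tp_gamma mu sigma2) 0%N)
    (translate (tp_shift mu sigma2)).

(* An expectation of a measurable function that equals a real number is that of
   an integrable function, since [+oo - +oo = -oo] in [\bar R]; so the first
   clause entails that [W] is integrable.
   ``The expectations exist'' means that the three integrands are integrable.
   As [W] and [W'] are integer valued, only the values of [f] on the integers
   matter. *)
Definition approx_stein_coupling d (T : measurableType d) (R : realType)
    (P : probability T R) (mu : R)
    (W W' : {RV P >-> int}) (G Rm : {RV P >-> R}) : Prop :=
  [/\ ('E_P[fun w => (W w)%:~R] = mu%:E)%E,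
      P.-integrable setT (fun w => (G w * (W' w - W w)%:~R)%:E) &
      forall f : int -> R,
        P.-integrable setT (fun w => (G w * (f (W' w) - f (W w)))%:E) ->
        P.-integrable setT (fun w => (((W w)%:~R - mu) * f (W w))%:E) ->
        P.-integrable setT (fun w => (Rm w * f (W w))%:E) ->
        ('E_P[fun w => (G w * (f (W' w) - f (W w)))%R] =
         'E_P[fun w => (((W w)%:~R - mu) * f (W w))%R] +
         'E_P[fun w => (Rm w * f (W w))%R])%E].

(* Main.v *)
Require Import Defs.
From HB Require Import structures.
From mathcomp Require Import all_boot all_order all_algebra.
From mathcomp Require Import all_classical all_reals all_analysis.
From mathcomp Require Import measurable_realfun ring lra.

Set Implicit Arguments.
Unset Strict Implicit.
Unset Printing Implicit Defensive.

Import Order.TTheory GRing.Theory Num.Theory.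
Import numFieldNormedType.Exports.

Local Open Scope classical_set_scope.
Local Open Scope ring_scope.

(* Write [lam = sigma^2 + gamma] and let [s] be the shift, so that [s + lam = mu].
   The solution [g] of the translated Poisson Stein equation of a set [A] satisfies
   [lam * Delta g k - (k - mu) * g k = 1_A k - TP A] for [k >= s] and vanishes below
   [s]; the event [W < s] costs at most [1 / sigma^2] by Chebyshev's inequality.
   The coupling equation for [g], expanded by
   [g (W + D) - g W = D * Delta g W + remainder], and the one for [k |-> k - mu], which
   gives [E GD = sigma^2 + E R (W - mu)], bound the expectation of the left-hand side
   at [W]. The remainder is a sum of [D (D - 1) / 2] second differences of shifts of
   [g], so conditionally on [F2] it is controlled by [|g| * S_2 / 2].

   The inputs on the Poisson law are [|g| <= 1 / sqrt lam] and [|Delta g| <= 1 / lam],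
   and for a singleton [|g| <= 1 / lam]; in the latter case [Delta g] is bounded
   pointwise through the Stein equation itself. The first of these amounts to
   [P(X <= k) P(X > k) <= sqrt lam * P(X = k)], which follows from the log-concavity
   of the Poisson weights and of their iterated partial and tail sums. *)

(** * Poisson tails *)

(** The shift must be an integer, so the Poisson parameter [lam] fits the mean exactly and exceeds
    the variance by [gamma <= 1]. This mismatch, multiplied by the bound on [Delta g], and the
    Chebyshev term cost at most [1 / sigma^2] each; together they account for the constant part of
    [2 * (Upsilon + 1)]. Second differences of [g] itself are never estimated. [S_2] puts both
    differences on the conditional law of [W], so the remainder needs only the supremum of [|g|],
    and its size [1 / sqrt lam] decides the order [1 / sigma] of the total variation bound. Ratios
    of neighbouring weights and sums control [Delta g] but do not show the scale [sqrt lam]; the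
    second iterated sums are introduced to reach it. Integrability is known for [G * D] and not for
    [G], so each estimate of the remainder has to vanish where [D = 0]. Finally [E R^2], [Upsilon]
    and [E Psi |W - mu|] may be infinite. Those cases are trivial and are split off first, which
    leaves inequalities between reals. *)

(** [C * B - A] is nonincreasing beyond [k] and tends to [0], hence is nonnegative at [k]. Tails are
    described by their recursion and limit rather than as series, so that closed forms can be
    plugged in directly. *)
Lemma tail_le (R : realType) (A B a b : R^nat) (C : R) (k : nat) :
  A @ \oo --> (0 : R) -> B @ \oo --> (0 : R) ->
  (forall j, A j = A j.+1 + a j.+1) -> (forall j, B j = B j.+1 + b j.+1) ->
  (forall j, (k < j)%N -> a j <= C * b j) -> A k <= C * B k.
Proof.
move=> A0 B0 AE BE ab.
pose u n := C * B (k + n)%N - A (k + n)%N.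
have uc : u @ \oo --> (0 : R).
  rewrite -(subrr 0) -{1}(mulr0 C).
  have sh (v : R^nat) : v @ \oo --> (0 : R) -> (fun n => v (k + n)%N) @ \oo --> (0 : R).
    move=> v0; rewrite (_ : (fun n => _) = (fun n => v (n + k)%N)).
      by rewrite cvg_shiftn.
    by apply/funext => n; rewrite addnC.
  by apply: cvgB; [apply: cvgMl_tmp|]; exact: sh.
have du : nonincreasing_seq u.
  apply/nonincreasing_seqP => n; rewrite /u addnS.
  rewrite [A (k + n)%N]AE [B (k + n)%N]BE.
  have := ab (k + n).+1; rewrite ltnS leq_addr => /(_ isT); lra.
have := nonincreasing_cvgn_ge du (cvgP _ uc) 0%N.
rewrite (cvg_lim _ uc)// /u addn0; lra.
Qed.

Lemma cvgS (R : realType) (u : R^nat) (l : R) :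
  (fun k => u k.+1) @ \oo --> l -> u @ \oo --> l.
Proof. by rewrite (cvg_shiftS u). Qed.

Lemma ratio_le (R : realType) (a b : R^nat) : (forall k, 0 < b k) ->
  (forall k, a k.+1 * b k <= b k.+1 * a k) ->
  forall k j, (k <= j)%N -> a j * b k <= b j * a k.
Proof.
move=> b0 ab k j; elim: j => [|j IH]; first by rewrite leqn0 => /eqP ->; rewrite mulrC.
rewrite leq_eqVlt => /predU1P[->|]; first by rewrite mulrC.
rewrite ltnS => /IH kj; rewrite -(ler_pM2r (b0 j)).
apply: (@le_trans _ _ (b j.+1 * (a j * b k))).
  by rewrite mulrAC [leRHS]mulrA ler_wpM2r ?ab// ltW.
by rewrite -[leRHS]mulrA [a k * _]mulrC ler_wpM2l// ltW.
Qed.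

(** Log-concavity makes [a j.+1 / a j] nonincreasing, so each term of the tail [A k.+1] is at most
    [a k.+1 / a k] times the corresponding term of [A k]. Expanding one factor on each side of the
    second claim reduces it to the first at [k.+1]. *)
Lemma tail_logconcave (R : realType) (a A : R^nat) :
  (forall k, 0 < a k) -> (forall k, a k.+2 * a k <= a k.+1 ^+ 2) ->
  A @ \oo --> (0 : R) -> (forall k, A k = A k.+1 + a k.+1) ->
  (forall k, A k.+1 * a k <= a k.+1 * A k) /\
  (forall k, A k.+2 * A k <= A k.+1 ^+ 2).
Proof.
move=> a0 aa A0 AE.
have A1 k : A k.+1 * a k <= a k.+1 * A k.
  rewrite -ler_pdivlMr// mulrAC.
  apply: (tail_le (A := fun k => A k.+1) (a := fun k => a k.+1) (b := a)) => //.
    by rewrite (cvg_shiftS A).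
  move=> j kj; rewrite mulrAC ler_pdivlMr//.
  by rewrite [leRHS]mulrC (ratio_le (a := fun k => a k.+1) a0 aa)// ltnW.
split=> // k; rewrite expr2 [A k]AE [X in _ <= X * _]AE mulrDr mulrDl lerD2l.
exact: A1.
Qed.

Lemma sum_logconcave (R : realType) (a A : R^nat) :
  (forall k, 0 < a k) -> (forall k, a k.+2 * a k <= a k.+1 ^+ 2) ->
  A 0%N = a 0%N -> (forall k, A k.+1 = A k + a k.+1) ->
  (forall k, A k * a k.+1 <= A k.+1 * a k) /\
  (forall k, A k.+2 * A k <= A k.+1 ^+ 2).
Proof.
move=> a0 aa A0 AS.
have Agt0 k : 0 < A k by elim: k => [|k IH]; rewrite ?A0 ?AS ?addr_gt0.
(* This consequence of the ratio inequality serves twice: it is the induction step for [A1] and,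
   after expansion, the log-concavity of [A]. *)
have A2 k : A k * a k.+1 <= A k.+1 * a k -> A k * a k.+2 <= A k.+1 * a k.+1.
  move=> A1; rewrite -(ler_pM2r (a0 k)) (@le_trans _ _ (A k * a k.+1 * a k.+1))//.
    by rewrite -!mulrA ler_wpM2l// ltW.
  by rewrite [leRHS]mulrAC ler_wpM2r// ltW.
have A1 k : A k * a k.+1 <= A k.+1 * a k.
  elim: k => [|k /A2 IH]; first by rewrite AS A0 mulrDl mulrC lerDr mulr_ge0// ltW.
  by rewrite {1}AS [A k.+2]AS !mulrDl [a k.+2 * _]mulrC lerD2r.
split=> // k; rewrite [A k.+2]AS expr2 {3}AS mulrDl mulrDr lerD2l mulrC.
exact/A2/A1.
Qed.

Section Poisson.
Context {R : realType} (lam : R) (lam_gt0 : 0 < lam).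
Local Notation p := (poisson_pmf lam).

Definition poisson_cdf (k : nat) : R := \sum_(0 <= j < k.+1) p j.
Definition poisson_tail (k : nat) : R := 1 - poisson_cdf k.
Local Notation F := poisson_cdf.
Local Notation q := poisson_tail.

Lemma poisson_pmfE k : p k = expR (- lam) * (lam ^+ k / k`!%:R).
Proof. by rewrite /poisson_pmf lam_gt0 mulrC. Qed.

Lemma poisson_pmf_gt0 k : 0 < p k.
Proof.
by rewrite poisson_pmfE mulr_gt0 ?expR_gt0// divr_gt0 ?exprn_gt0// ltr0n fact_gt0.
Qed.

Lemma poisson_pmfS k : p k.+1 * k.+1%:R = lam * p k.
Proof.
have k0 : k`!%:R != 0 :> R by rewrite pnatr_eq0 -lt0n fact_gt0.
have k1 : k.+1%:R != 0 :> R by rewrite pnatr_eq0.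
by rewrite !poisson_pmfE factS natrM exprS; field; rewrite k0 -natr1 addrC in k1 *.
Qed.

Lemma poisson_cdf0 : F 0%N = p 0%N.
Proof. by rewrite /F big_nat1. Qed.

Lemma poisson_cdfS k : F k.+1 = F k + p k.+1.
Proof. by rewrite /F big_nat_recr. Qed.

Lemma poisson_cdf_gt0 k : 0 < F k.
Proof.
elim: k => [|k IH]; first by rewrite poisson_cdf0 poisson_pmf_gt0.
by rewrite poisson_cdfS addr_gt0// poisson_pmf_gt0.
Qed.

Lemma cvg_poisson_tail : q @ \oo --> (0 : R).
Proof.
rewrite -(subrr (1 : R)); apply: cvgB; first exact: cvg_cst.
rewrite -(mulVf (lt0r_neq0 (expR_gt0 lam))) -expRN.
rewrite (_ : F = (fun k => expR (- lam) * series (exp_coeff lam) k.+1)); last first.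
  apply/funext => k; rewrite /F /series/= big_distrr/=; apply: eq_bigr => j _.
  by rewrite poisson_pmfE.
apply: cvgMl_tmp.
rewrite (cvg_shiftS (series (exp_coeff lam))).
exact: is_cvg_series_exp_coeff.
Qed.

Lemma poisson_tailS k : q k = q k.+1 + p k.+1.
Proof. by rewrite /q poisson_cdfS opprD addrA subrK. Qed.

Lemma cvg_poisson_pmf : p @ \oo --> (0 : R).
Proof.
apply: cvgS; rewrite (_ : (fun n => _) = (fun n => q n - q n.+1)); last first.
  by apply/funext => n; rewrite /= (poisson_tailS n) addrAC subrr add0r.
rewrite -(subrr (0 : R)); apply: cvgB; first exact: cvg_poisson_tail.
by rewrite (cvg_shiftS q); exact: cvg_poisson_tail.
Qed.

Lemma poisson_tail_gt0 k : 0 < q k.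
Proof.
have tail_ge0 j : 0 <= q j.
  have : nonincreasing_seq q.
    apply/nonincreasing_seqP => n; rewrite (poisson_tailS n) lerDl.
    exact/ltW/poisson_pmf_gt0.
  move=> /nonincreasing_cvgn_ge /(_ (cvgP _ cvg_poisson_tail) j).
  by rewrite (cvg_lim _ cvg_poisson_tail).
by rewrite poisson_tailS ltr_wpDl// poisson_pmf_gt0.
Qed.

Lemma poisson_pmf_logconcave k : p k.+2 * p k <= p k.+1 ^+ 2.
Proof.
have p0 := poisson_pmf_gt0.
rewrite -(ler_pM2r (_ : 0 < k.+2%:R)) ?ltr0n// mulrAC poisson_pmfS.
have -> : lam * p k.+1 * p k = p k.+1 ^+ 2 * k.+1%:R.
  by rewrite expr2 -[in RHS]mulrA poisson_pmfS; ring.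
by rewrite ler_wpM2l ?ler_nat// exprn_ge0// ltW.
Qed.

Lemma poisson_tail_ratio k : q k.+1 * p k <= p k.+1 * q k.
Proof.
have [h _] := tail_logconcave poisson_pmf_gt0 poisson_pmf_logconcave
  cvg_poisson_tail poisson_tailS.
exact: h.
Qed.

Lemma poisson_cdf_ratio k : F k * p k.+1 <= F k.+1 * p k.
Proof.
have [h _] := sum_logconcave poisson_pmf_gt0 poisson_pmf_logconcave poisson_cdf0 poisson_cdfS.
exact: h.
Qed.

(* For [X] Poisson, [poisson_excess k] is [E (X - k - 1)^+] and [poisson_excess2 k]
   is [E binomial((X - k - 1)^+, 2)]; both are iterated tail sums of the pmf, which
   inherit log-concavity from it. *)
Definition poisson_excess (k : nat) : R := lam * p k - (k.+1%:R - lam) * q k.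
Definition poisson_excess2 (k : nat) : R := (lam * q k - (k.+2%:R - lam) * poisson_excess k) / 2.

Lemma poisson_excessS k : poisson_excess k = poisson_excess k.+1 + q k.+1.
Proof.
have := poisson_pmfS k; rewrite /poisson_excess (poisson_tailS k) => e.
rewrite -e -[k.+2%:R]natr1; ring.
Qed.

Lemma poisson_excess2S k : poisson_excess2 k = poisson_excess2 k.+1 + poisson_excess k.+1.
Proof.
rewrite /poisson_excess2 (poisson_excessS k) /poisson_excess (poisson_tailS k) -[k.+3%:R]natr1.
by field.
Qed.

Lemma cvg_natM_pmf : (fun k => k%:R * p k) @ \oo --> (0 : R).
Proof.
apply: cvgS; rewrite (_ : (fun k => _) = (fun k => lam * p k)); last first.
  by apply/funext => k /=; rewrite mulrC poisson_pmfS.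
by rewrite -(mulr0 lam); apply: cvgMl_tmp; exact: cvg_poisson_pmf.
Qed.

Lemma cvg_sqrM_pmf : (fun k => k%:R ^+ 2 * p k) @ \oo --> (0 : R).
Proof.
apply: cvgS; rewrite (_ : (fun k => _) = (fun k => lam * (k%:R * p k + p k))); last first.
  apply/funext => k /=; rewrite expr2 -mulrA [_ * p _]mulrC poisson_pmfS.
  rewrite -natr1; ring.
rewrite -(mulr0 lam) -(addr0 (0 : R)); apply: cvgMl_tmp; apply: cvgD.
  exact: cvg_natM_pmf.
exact: cvg_poisson_pmf.
Qed.

(** From [2 * lam] on, consecutive weights at least halve, so [p j <= p j.-1 - p j], and the
    right-hand side telescopes. This transfers polynomially weighted decay from the weights to the
    tails. *)
Lemma poisson_tail_le_pmf k : 2 * lam <= k.+1%:R -> q k <= p k.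
Proof.
move=> lk; rewrite -[leRHS]mul1r.
apply: (tail_le (a := p) (b := fun j => p j.-1 - p j) (B := p)).
- exact: cvg_poisson_tail.
- exact: cvg_poisson_pmf.
- exact: poisson_tailS.
- by move=> j; rewrite /= addrC subrK.
case=> // j kj; rewrite mul1r lerBrDr /= -(ler_pM2r lam_gt0) [leRHS]mulrC.
rewrite -poisson_pmfS (_ : _ * lam = p j.+1 * (2 * lam)); last by ring.
rewrite ler_wpM2l ?(ltW (poisson_pmf_gt0 _))// (le_trans lk)//.
by rewrite ler_nat.
Qed.

Lemma cvg_natXM_tail n : (fun k => k%:R ^+ n * p k) @ \oo --> (0 : R) ->
  (fun k => k%:R ^+ n * q k) @ \oo --> (0 : R).
Proof.
apply: (squeeze_cvgr _ (cvg_cst (0 : R))).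
near=> k; rewrite mulr_ge0 ?(ltW (poisson_tail_gt0 _))//=.
rewrite ler_wpM2l//; apply: poisson_tail_le_pmf.
near: k; exists (Num.truncn (2 * lam)) => // k /= lk.
have := truncnS_gt (2 * lam) => /ltW /le_trans; apply.
by rewrite ler_nat ltnS.
Unshelve. all: end_near. Qed.

Lemma cvg_poisson_excess : poisson_excess @ \oo --> (0 : R).
Proof.
rewrite (_ : poisson_excess = (fun k => lam * p k - k%:R ^+ 1 * q k - (1 - lam) * q k)).
  rewrite (_ : 0 = lam * 0 - 0 - (1 - lam) * 0); last by ring.
  have qc := cvg_poisson_tail; have pc := cvg_poisson_pmf.
  apply: cvgB; last exact: cvgMl_tmp.
  apply: cvgB; first exact: cvgMl_tmp.
  by apply: cvg_natXM_tail; under eq_fun do rewrite expr1; exact: cvg_natM_pmf.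
by apply/funext => k; rewrite /poisson_excess -natr1; ring.
Qed.

Lemma cvg_poisson_excess2 : poisson_excess2 @ \oo --> (0 : R).
Proof.
rewrite (_ : poisson_excess2 = (fun k => 2^-1 * (lam * q k - lam * (k%:R * p k)
    + k%:R ^+ 2 * q k + (1 - lam) * (k%:R ^+ 1 * q k) - (2 - lam) * poisson_excess k))).
  rewrite (_ : 0 = 2^-1 * (lam * 0 - lam * 0 + 0 + (1 - lam) * 0 - (2 - lam) * 0)).
    have qc := cvg_poisson_tail; have pc := cvg_natM_pmf; have ec := cvg_poisson_excess.
    apply: cvgMl_tmp; apply: cvgB; last exact: cvgMl_tmp.
    apply: cvgD.
      apply: cvgD; last by apply: cvg_natXM_tail; exact: cvg_sqrM_pmf.
      by apply: cvgB; exact: cvgMl_tmp.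
    apply: cvgMl_tmp; apply: cvg_natXM_tail.
    by under eq_fun do rewrite expr1.
  by ring.
apply/funext => k; rewrite /poisson_excess2 /poisson_excess -[k.+2%:R]natr1 -[k.+1%:R]natr1; by field.
Qed.

Lemma poisson_excess_gt0 k : 0 < poisson_excess k.
Proof.
suff ge0 j : 0 <= poisson_excess j by rewrite poisson_excessS ltr_wpDl// poisson_tail_gt0.
have : nonincreasing_seq poisson_excess.
  by apply/nonincreasing_seqP => n; rewrite (poisson_excessS n) lerDl ltW// poisson_tail_gt0.
move=> /nonincreasing_cvgn_ge /(_ (cvgP _ cvg_poisson_excess) j).
by rewrite (cvg_lim _ cvg_poisson_excess).
Qed.

(** Log-concavity of [q] makes [poisson_excess / q] nonincreasing. Summing [poisson_excess j <=
    (poisson_excess k / q k) * q j] over [j > k] turns the left side into [poisson_excess2 k] and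
    the sum of [q j] into [poisson_excess k]. *)
Lemma poisson_excess2_le k : poisson_excess2 k * q k <= poisson_excess k ^+ 2.
Proof.
have q0 := poisson_tail_gt0.
have [_ qq] := tail_logconcave poisson_pmf_gt0 poisson_pmf_logconcave
  cvg_poisson_tail poisson_tailS.
have [Nq _] := tail_logconcave q0 qq cvg_poisson_excess poisson_excessS.
rewrite -ler_pdivlMr// expr2 mulrAC.
apply: (tail_le cvg_poisson_excess2 cvg_poisson_excess poisson_excess2S poisson_excessS) => j kj.
by rewrite mulrAC ler_pdivlMr// [leRHS]mulrC (ratio_le q0 Nq)// ltnW.
Qed.

(* Dually, [poisson_deficit k] is [E (k + 1 - X)^+] and [poisson_deficit2 k] is
   [E binomial((k + 2 - X)^+, 2)]. *)
Definition poisson_deficit (k : nat) : R := lam * p k + (k.+1%:R - lam) * F k.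

Lemma poisson_deficitS k : poisson_deficit k.+1 = poisson_deficit k + F k.+1.
Proof.
have := poisson_pmfS k; rewrite /poisson_deficit poisson_cdfS -[k.+2%:R]natr1 => e.
by rewrite !mulrDl mulrDr; lra.
Qed.

Lemma poisson_deficit0 : poisson_deficit 0 = F 0.
Proof. by rewrite /poisson_deficit poisson_cdf0; ring. Qed.

Lemma poisson_deficit_gt0 k : 0 < poisson_deficit k.
Proof.
elim: k => [|k IH]; first by rewrite poisson_deficit0 poisson_cdf_gt0.
by rewrite poisson_deficitS addr_gt0// poisson_cdf_gt0.
Qed.

Definition poisson_deficit2 (k : nat) : R := ((k.+2%:R - lam) * poisson_deficit k + lam * F k) / 2.

Lemma poisson_deficit2S k : poisson_deficit2 k.+1 = poisson_deficit2 k + poisson_deficit k.+1.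
Proof.
rewrite /poisson_deficit2 poisson_deficitS /poisson_deficit poisson_cdfS -[k.+3%:R]natr1 -[k.+2%:R]natr1.
have := poisson_pmfS k; rewrite -[k.+1%:R]natr1 => e.
have -> : lam * p k = p k.+1 * (k%:R + 1) by [].
by field.
Qed.

(** The sums are finite here, so induction replaces the passage to the limit; equality holds at [0].
    The step reduces to [deficit2 k * F k.+1 <= deficit k.+1 * deficit k], which follows after
    multiplication by [F k] from the induction hypothesis and the ratio inequality [GF]. *)
Lemma poisson_deficit2_le k : poisson_deficit2 k * F k <= poisson_deficit k ^+ 2.
Proof.
have F0 := poisson_cdf_gt0; have G0 := poisson_deficit_gt0.
have [_ FF] := sum_logconcave poisson_pmf_gt0 poisson_pmf_logconcave poisson_cdf0 poisson_cdfS.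
have [GF _] := sum_logconcave F0 FF poisson_deficit0 poisson_deficitS.
elim: k => [|k IH].
  by rewrite poisson_deficit0 /poisson_deficit2 poisson_deficit0 expr2 ler_wpM2r ?(ltW (F0 _))//; lra.
rewrite poisson_deficit2S mulrDl expr2 {3}poisson_deficitS mulrDr lerD2r.
rewrite -(ler_pM2r (F0 k)) mulrAC.
apply: (@le_trans _ _ (poisson_deficit k ^+ 2 * F k.+1)).
  by rewrite ler_wpM2r// ltW.
by rewrite expr2 -mulrA [leLHS]mulrC -[leRHS]mulrA [poisson_deficit k * F k]mulrC mulrA
  ler_wpM2r// ltW.
Qed.

(* Combining [poisson_excess2_le] with [poisson_deficit2_le] eliminates the term
   of indefinite sign and leaves [lam * q * F <= 2 * excess * deficit]; AM-GM with
   [excess * F + deficit * q = lam * p] concludes. *)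
Lemma poisson_cdf_tail_le k : F k * q k <= Num.sqrt lam * p k.
Proof.
have F0 := poisson_cdf_gt0 k; have q0 := poisson_tail_gt0 k.
have N0 := poisson_excess_gt0 k; have G0 := poisson_deficit_gt0 k; have p0 := poisson_pmf_gt0 k.
have hN := poisson_excess2_le k; have hG := poisson_deficit2_le k.
have c0 : poisson_excess k * F k + poisson_deficit k * q k = lam * p k.
  by rewrite /poisson_excess /poisson_deficit /poisson_tail; ring.
have {hN hG} key : lam * (q k * F k) <= 2 * (poisson_excess k * poisson_deficit k).
  have cp : 0 < lam * p k by rewrite mulr_gt0.
  rewrite -(ler_pM2r cp) -{1}c0.
  move: hN hG; rewrite /poisson_excess2 /poisson_deficit2.
  set N := poisson_excess k in N0 *; set G := poisson_deficit k in G0 *; set x := F k in F0 *.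
  set y := q k in q0 *; set v := k.+2%:R - lam => hN hG.
  have c1 : N * x + G * y = lam * p k by [].
  rewrite -c1.
  (* With the weights [x * G] and [y * N] the two terms in [v] cancel in the sum, and the common
     factor [N * x + G * y = lam * p k] can be divided out. *)
  have {}hN : (lam * y - v * N) * y * (x * G) <= 2 * N ^+ 2 * (x * G).
    by apply: ler_wpM2r; [rewrite mulr_ge0// ltW|lra].
  have {}hG : (v * G + lam * x) * x * (y * N) <= 2 * G ^+ 2 * (y * N).
    by apply: ler_wpM2r; [rewrite mulr_ge0// ltW|lra].
  lra.
(* AM-GM would even give an extra factor [1/2] on the right; it is dropped. *)
have le2 : (F k * q k) ^+ 2 <= lam * p k ^+ 2.
  rewrite -(ler_pM2l lam_gt0).
  apply: (@le_trans _ _ (2 * (poisson_excess k * F k) * (poisson_deficit k * q k))).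
    have := ler_wpM2r (ltW (mulr_gt0 F0 q0)) key; lra.
  rewrite (_ : lam * (lam * _) = (lam * p k) ^+ 2); last by ring.
  rewrite -c0; have := sqr_ge0 (poisson_excess k * F k - poisson_deficit k * q k).
  have := sqr_ge0 (poisson_excess k * F k + poisson_deficit k * q k); lra.
rewrite -ler_sqr ?nnegrE ?mulr_ge0 ?sqrtr_ge0 ?(ltW F0) ?(ltW q0) ?(ltW p0)//.
by rewrite [leRHS]exprMn sqr_sqrtr// ltW.
Qed.

End Poisson.

(* The integral of the concave function [1 + ln] over [m - h, m + h] is at most
   [2 h] times its midpoint value. *)
Lemma xlnx_midpoint (R : realType) (m h : R) : 0 < h -> h < m ->
  (m + h) * ln (m + h) - (m - h) * ln (m - h) <= 2 * h * (1 + ln m).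
Proof.
move=> h0 hm; have m0 : 0 < m by lra.
pose f (x : R) := (m + x) * ln (m + x) - (m - x) * ln (m - x) - 2 * x * (1 + ln m).
pose df (x : R) := ln (m + x) + ln (m - x) - 2 * ln m.
have fd (x : R) : 0 <= x <= h -> is_derive x 1 f (df x).
  move=> /andP[x0 xh].
  have xl (y : R) : 0 < y -> is_derive y 1 (fun z => z * ln z) (1 + ln y).
    move=> y0; have l1 := is_derive1_ln y0.
    have := is_deriveM (is_derive_id y 1) l1.
    by rewrite /GRing.scale/= divff ?gt_eqF// mulr1.
  have d1 : is_derive x 1 (+%R m) (0 + 1).
    by apply: is_deriveD.
  have d2 : is_derive x 1 (fun x => m - x) (0 - 1).
    by apply: is_deriveB.
  have e1 : is_derive x 1 ((fun z => z * ln z) \o +%R m) ((1 + ln (m + x)) * (0 + 1)).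
    by apply: is_derive1_comp; apply: xl; lra.
  have e2 : is_derive x 1 ((fun z => z * ln z) \o (fun x => m - x)) ((1 + ln (m - x)) * (0 - 1)).
    by apply: is_derive1_comp; apply: xl; lra.
  have e3 : is_derive x 1 (( *%R (2 * (1 + ln m))) : R -> R) (2 * (1 + ln m)).
    have := is_deriveZ (2 * (1 + ln m)) (is_derive_id x (1 : R)).
    by rewrite /GRing.scale/= mulr1.
  rewrite (_ : f = ((fun z => z * ln z) \o +%R m) - ((fun z => z * ln z) \o (fun x => m - x))
     - ( *%R (2 * (1 + ln m)))); last first.
    by apply/funext => y; rewrite /f !fctE/=; ring.
  rewrite (_ : df x = (1 + ln (m + x)) * (0 + 1) - (1 + ln (m - x)) * (0 - 1) - 2 * (1 + ln m)).
    by apply: is_deriveB.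
  rewrite /df; ring.
have fc : {within `[0, h], continuous f}.
  apply: derivable_within_continuous => x; rewrite in_itv/= => /fd h1; exact: ex_derive.
have [c] := MVT h0 (fun x hx => fd x (subset_itv_oo_cc hx)) fc.
rewrite in_itv/= subr0 => /andP[c0 ch] e.
(* [df x] equals [ln (m^2 - x^2) - ln (m^2)], which is nonpositive, and [f 0 = 0]. *)
have : f h <= f 0.
  rewrite -subr_le0 e; apply: mulr_le0_ge0; last exact: ltW.
  rewrite /df -lnM ?posrE ?subr_gt0 ?addr_gt0//; last lra.
  rewrite subr_le0 (_ : 2 * ln m = ln (m ^+ 2)) ?ler_ln ?posrE; last by rewrite lnXn// mulr_natl.
  - nra.
  - by rewrite mulr_gt0//; lra.
  - by rewrite exprn_gt0.
rewrite /f !addr0 !subr0; lra.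
Qed.

(** This is [lam * p(a)^2 <= 1 / (2 e)] at the maximiser [lam = a + 1/2], cleared of denominators,
    with equality at [a = 0]. The induction step compares the quotient of consecutive left-hand
    sides with [e^2 * m^2] for [m = a + 1]; its logarithm is twice [xlnx_midpoint] at [h = 1/2]. *)
Lemma half_pow_le_fact (R : realType) (a : nat) :
  2 * (a%:R + 2^-1) ^+ (2 * a).+1 <= expR (2 * a)%:R * (a`!%:R : R) ^+ 2.
Proof.
elim: a => [|a IH]; first by rewrite muln0 fact0 expR0; lra.
set m : R := a.+1%:R.
have m1 : 1 <= m by rewrite ler1n.
have m0 : 0 < m by lra.
have key : (m + 2^-1) ^+ (2 * a.+1).+1 <=
    expR 2 * m ^+ 2 * (a%:R + 2^-1) ^+ (2 * a).+1.
  have am : a%:R + 2^-1 = m - 2^-1 by rewrite /m -[a.+1%:R]natr1; lra.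
  rewrite am -ler_ln ?posrE; last 2 first.
  - by rewrite exprn_gt0//; lra.
  - by rewrite !mulr_gt0 ?expR_gt0 ?exprn_gt0//; lra.
  rewrite lnM ?posrE; last 2 first.
  - by rewrite mulr_gt0 ?expR_gt0 ?exprn_gt0//; lra.
  - by rewrite exprn_gt0//; lra.
  rewrite lnM ?posrE ?expR_gt0 ?exprn_gt0//.
  have lnX (y : R) (n : nat) : 0 < y -> ln (y ^+ n) = n%:R * ln y.
    by move=> y0; rewrite lnXn// mulr_natl.
  rewrite expRK !lnX; [|lra|lra|lra].
  have := @xlnx_midpoint R m 2^-1 ltac:(lra) ltac:(lra).
  rewrite -[(2 * a.+1).+1%:R]natr1 -[(2 * a).+1%:R]natr1 !natrM -/m.
  have -> : a%:R = m - 1 by rewrite /m -[a.+1%:R]natr1 addrK.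
  lra.
apply: (le_trans (_ : _ <= expR 2 * m ^+ 2 * (2 * (a%:R + 2^-1) ^+ (2 * a).+1))).
  by rewrite [leRHS]mulrCA ler_wpM2l.
rewrite factS [(a.+1 * _)%:R]natrM exprMn mulnS natrD [expR (_ + (2 * a)%:R)]expRD -/m.
rewrite [leRHS](_ : _ = expR 2 * m ^+ 2 * (expR (2 * a)%:R * a`!%:R ^+ 2)); last by ring.
by rewrite ler_wpM2l// mulr_ge0 ?expR_ge0 ?sqr_ge0.
Qed.

(* [sqrt lam * poisson_pmf lam k] is maximal at [lam = k + 1/2], and its maximum
   decreases with [k], with value [1 / sqrt (2 e)] at [k = 0]. *)
Lemma poisson_pmf_le (R : realType) (lam : R) (k : nat) : 0 < lam ->
  poisson_pmf lam k <= (Num.sqrt (2 * expR 1 * lam))^-1.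
Proof.
move=> lam0; have p0 := poisson_pmf_gt0 lam0 k.
have e0 : 0 < 2 * expR 1 * lam by rewrite !mulr_gt0 ?expR_gt0.
set h : R := k%:R + 2^-1; have h0 : 0 < h by rewrite /h ltr_wpDl.
(* The maximisation over [lam] without derivatives: [1 + x <= exp x] at [x = lam / h - 1] gives
   [lam <= h * exp (lam / h - 1)], which is raised to the power [2 k + 1 = 2 h]. *)
have powle : lam ^+ (2 * k).+1 <= h ^+ (2 * k).+1 * expR (2 * lam - (2 * k).+1%:R).
  have lamh : lam <= h * expR (lam / h - 1).
    rewrite mulrC -ler_pdivrMr//; have := expR_ge1Dx (lam / h - 1); lra.
  have he0 : 0 <= h * expR (lam / h - 1) by rewrite (le_trans (ltW lam0) lamh).
  rewrite (_ : 2 * lam - (2 * k).+1%:R = (2 * k).+1%:R * (lam / h - 1)).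
    by rewrite expRM_natl -exprMn; apply: lerXn2r lamh; rewrite nnegrE// ltW.
  have -> : (2 * k).+1%:R = 2 * h :> R by rewrite -natr1 natrM /h mulrDr divff.
  by field; rewrite gt_eqF.
rewrite -[leRHS]mul1r ler_pdivlMr ?sqrtr_gt0//.
rewrite -ler_sqr ?nnegrE ?mulr_ge0 ?sqrtr_ge0 ?(ltW p0)// expr1n exprMn sqr_sqrtr ?(ltW e0)//.
have f0 : 0 < (k`!%:R : R) by rewrite ltr0n fact_gt0.
rewrite poisson_pmfE//.
rewrite [leLHS](_ : _ = 2 * expR 1 * expR (- lam) ^+ 2 * lam ^+ (2 * k).+1 / k`!%:R ^+ 2); last first.
  have -> : lam ^+ (2 * k).+1 = lam * (lam ^+ k) ^+ 2 by rewrite exprS mulnC exprM.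
  by field; rewrite gt_eqF.
rewrite ler_pdivrMr ?exprn_gt0// mul1r.
apply: (@le_trans _ _ (2 * expR 1 * expR (- lam) ^+ 2 * (h ^+ (2 * k).+1 * expR (2 * lam - (2 * k).+1%:R)))).
  by rewrite ler_wpM2l// !mulr_ge0 ?expR_ge0 ?sqr_ge0.
rewrite -expRM_natl -[(2 * k).+1%:R]natr1.
rewrite (_ : expR (2 * lam - ((2 * k)%:R + 1)) = expR (2 * lam) / (expR (2 * k)%:R * expR 1)); last first.
  by rewrite expRD expRN expRD.
rewrite mulrN expRN.
rewrite [leLHS](_ : _ = (expR (2 * k)%:R)^-1 * (2 * h ^+ (2 * k).+1)); last first.
  by field; rewrite !gt_eqF ?expR_gt0.
by rewrite mulrC ler_pdivrMr ?expR_gt0// [leRHS]mulrC; exact: half_pow_le_fact.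
Qed.

(** * The Stein equation of the Poisson law *)

Section PoissonStein.
Context {R : realType} (lam : R) (lam_gt0 : 0 < lam).
Local Notation p := (poisson_pmf lam).
Local Notation F := (poisson_cdf lam).
Local Notation q := (poisson_tail lam).

Definition poisson_mass (A : set nat) : R := fine (poisson_prob lam 0%N A).
Definition mass_upto (A : set nat) (k : nat) : R := \sum_(0 <= j < k.+1) \1_A j * p j.

Lemma cvg_mass_upto A : mass_upto A @ \oo --> poisson_mass A.
Proof.
have p0 := poisson_pmf_gt0 lam_gt0.
have a0 j : 0 <= \1_A j * p j by rewrite mulr_ge0 ?(ltW (p0 _)).
have e : poisson_prob lam 0%N A = (\sum_(0 <= j <oo) (\1_A j * p j)%:E)%E.
  rewrite /poisson_prob lam_gt0 esum_mkcond nneseries_esumT; last first.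
    by move=> j; rewrite lee_fin.
  apply: eq_esum => j _; rewrite indicE; case: ifPn => _; first by rewrite mul1r.
  by rewrite mul0r.
have fin : poisson_prob lam 0%N A \is a fin_num by exact: fin_num_measure.
have : (fun n => \sum_(0 <= j < n) (\1_A j * p j)%:E)%E @ \oo -->
    (poisson_mass A)%:E.
  by rewrite /poisson_mass fineK// e; apply: is_cvg_nneseries => j _ _; rewrite lee_fin.
move=> /fine_cvg h; rewrite -(cvg_shiftS (fine \o _)) in h.
apply: cvg_trans h; apply: near_eq_cvg; apply: nearW => n /=.
by rewrite sumEFin.
Qed.

Lemma mass_upto0 A : mass_upto A 0%N = \1_A 0%N * p 0%N.
Proof. by rewrite /mass_upto big_nat1. Qed.

Lemma mass_uptoS A k : mass_upto A k.+1 = mass_upto A k + \1_A k.+1 * p k.+1.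
Proof. by rewrite /mass_upto big_nat_recr. Qed.

Definition mass_above (A : set nat) (k : nat) : R := poisson_mass A - mass_upto A k.

Lemma mass_aboveS A k : mass_above A k = mass_above A k.+1 + \1_A k.+1 * p k.+1.
Proof. by rewrite /mass_above mass_uptoS opprD addrA subrK. Qed.

Lemma indic01 A (j : nat) : 0 <= (\1_A j : R) <= 1.
Proof. by rewrite indicE; case: (_ \in _); rewrite /= ?lexx ?ler01. Qed.

Lemma mass_upto_bounds A k : 0 <= mass_upto A k <= F k.
Proof.
have p0 := poisson_pmf_gt0 lam_gt0.
apply/andP; split.
  by apply: sumr_ge0 => j _; have /andP[? _] := indic01 A j; rewrite mulr_ge0// ltW.
apply: ler_sum => j _; have /andP[_ h] := indic01 A j.
by rewrite ler_piMl// ltW.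
Qed.

Lemma mass_above_bounds A k : 0 <= mass_above A k <= q k.
Proof.
have p0 := poisson_pmf_gt0 lam_gt0.
have t0 : mass_above A @ \oo --> (0 : R).
  rewrite -(subrr (poisson_mass A)); apply: cvgB; first exact: cvg_cst.
  exact: cvg_mass_upto.
have q0 := cvg_poisson_tail lam_gt0; have qS := poisson_tailS lam.
apply/andP; split.
  have : 0 * q k <= 1 * mass_above A k.
    rewrite mul0r mul1r -subr_ge0 subr0.
    have : - mass_above A k <= 0 * q k; last by rewrite mul0r oppr_le0.
    apply: (tail_le (A := fun k => - mass_above A k) (a := fun j => - (\1_A j * p j)) _ q0 _ qS).
    - by rewrite -oppr0; exact: cvgN.
    - by move=> j; rewrite mass_aboveS opprD.
    move=> j _; rewrite mul0r oppr_le0 mulr_ge0 ?(ltW (p0 _))//.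
  by rewrite mul0r mul1r.
rewrite -[leRHS]mul1r; apply: (tail_le (a := fun j => \1_A j * p j) t0 q0 (mass_aboveS A) qS) => j _.
by rewrite /= mul1r ler_piMl ?(ltW (p0 _))//; have /andP[] := indic01 A j.
Qed.

(** The Stein equation at [0] multiplies the value at [0] by zero, so this value is free. The choice
    [0] fits the zero extension below the shift. *)
Definition poisson_stein (A : set nat) (k : nat) : R :=
  if k is j.+1 then (mass_upto A j - poisson_mass A * F j) / (lam * p j) else 0.

(** Splitting the mass of [A] at [k] and using [F + q = 1] writes the solution as a difference of
    two nonnegative terms. All bounds start here: after multiplication by [p k] each term lies
    between [0] and [F k * q k], and the ratios [q / p] and [F / p] are monotone. *)
Lemma poisson_steinE A k :
  lam * poisson_stein A k.+1 = mass_upto A k * (q k / p k) - mass_above A k * (F k / p k).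
Proof.
have p0 := poisson_pmf_gt0 lam_gt0 k.
by rewrite /poisson_stein /mass_above /poisson_tail; field; rewrite !gt_eqF.
Qed.

Lemma poisson_stein_eq A k : lam * poisson_stein A k.+1 - k%:R * poisson_stein A k = \1_A k - poisson_mass A.
Proof.
have p0 := poisson_pmf_gt0 lam_gt0.
case: k => [|k].
  by rewrite mul0r subr0 /= mass_upto0 poisson_cdf0; field; rewrite !gt_eqF.
rewrite /= mass_uptoS poisson_cdfS.
have e : lam * p k = p k.+1 * k.+1%:R by rewrite poisson_pmfS.
by rewrite e; field; rewrite !gt_eqF//=.
Qed.

Lemma poisson_cdf_add_tail k : F k + q k = 1.
Proof. by rewrite /poisson_tail addrC subrK. Qed.

Lemma norm_poisson_stein_le A k : `|poisson_stein A k| <= (Num.sqrt lam)^-1.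
Proof.
case: k => [|k]; first by rewrite normr0 invr_ge0 sqrtr_ge0.
have s0 : 0 < Num.sqrt lam by rewrite sqrtr_gt0.
have p0 := poisson_pmf_gt0 lam_gt0 k.
have F0 := poisson_cdf_gt0 lam_gt0 k; have q0 := poisson_tail_gt0 lam_gt0 k.
have /andP[sg sl] := mass_upto_bounds A k; have /andP[tg tl] := mass_above_bounds A k.
have key : `|lam * p k * poisson_stein A k.+1| <= F k * q k.
  rewrite (_ : _ * _ = mass_upto A k * q k - mass_above A k * F k); last first.
    by rewrite mulrAC poisson_steinE; field; rewrite gt_eqF.
  have h1 : mass_upto A k * q k <= F k * q k by rewrite ler_wpM2r// ltW.
  have h2 : mass_above A k * F k <= F k * q k by rewrite mulrC ler_wpM2l// ltW.
  have h3 : 0 <= mass_upto A k * q k by rewrite mulr_ge0// ltW.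
  have h4 : 0 <= mass_above A k * F k by rewrite mulr_ge0// ltW.
  rewrite ler_norml; lra.
have {key} := le_trans key (poisson_cdf_tail_le lam_gt0 k).
rewrite normrM gtr0_norm ?mulr_gt0// [leRHS]mulrC mulrAC [lam * _ * _]mulrC ler_pM2l// => h.
rewrite -[leRHS]mul1r ler_pdivlMr// -(ler_pM2r s0) mul1r -mulrA.
by rewrite -expr2 sqr_sqrtr ?(ltW lam_gt0)// mulrC.
Qed.

Lemma tail_pmf_ratio_le k : q k.+1 / p k.+1 <= q k / p k.
Proof.
have p0 := poisson_pmf_gt0 lam_gt0.
rewrite ler_pdivrMr// mulrAC ler_pdivlMr// [leRHS]mulrC.
exact: poisson_tail_ratio.
Qed.

Lemma cdf_pmf_ratio_le k : F k / p k <= F k.+1 / p k.+1.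
Proof.
have p0 := poisson_pmf_gt0 lam_gt0.
rewrite ler_pdivrMr// mulrAC ler_pdivlMr//.
exact: poisson_cdf_ratio.
Qed.

(** From [k] to [k.+1] the ratio [q / p] falls and [F / p] grows, so the mass of [A] up to [k] and
    the mass beyond [k.+1] both contribute nonpositively. Only the point [k.+1] remains, and it
    contributes at most [F k.+1 + q k.+1 = 1]. The lower bound follows from the complement of [A],
    whose solution is the negative. *)
Lemma diff_poisson_stein_le A k : poisson_stein A k.+1 - poisson_stein A k <= lam^-1.
Proof.
have p0 := poisson_pmf_gt0 lam_gt0.
rewrite -[leRHS]mul1r ler_pdivlMr// mulrC mulrBr poisson_steinE.
case: k => [|k].
  rewrite /= mulr0 subr0.
  have /andP[_ sl] := mass_upto_bounds A 0; have /andP[tg _] := mass_above_bounds A 0.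
  have F0 := poisson_cdf_gt0 lam_gt0 0; have q0 := poisson_tail_gt0 lam_gt0 0.
  have : mass_upto A 0 * (q 0 / p 0) <= F 0 * (q 0 / p 0).
    by rewrite ler_wpM2r// divr_ge0// ltW.
  have : 0 <= mass_above A 0 * (F 0 / p 0) by rewrite mulr_ge0// divr_ge0// ltW.
  have : F 0 * (q 0 / p 0) = q 0 by rewrite poisson_cdf0; field; rewrite gt_eqF.
  have := poisson_cdf_add_tail 0; lra.
rewrite !poisson_steinE [mass_above A k]mass_aboveS mass_uptoS.
have /andP[sg _] := mass_upto_bounds A k; have /andP[tg _] := mass_above_bounds A k.+1.
have h1 := ler_wpM2l sg (tail_pmf_ratio_le k).
have h2 := ler_wpM2l tg (cdf_pmf_ratio_le k).
have /andP[e0 e1] := indic01 A k.+1.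
have ep : 0 <= \1_A k.+1 * p k.+1 by rewrite mulr_ge0// ltW.
have h3 := ler_wpM2l ep (cdf_pmf_ratio_le k).
have : \1_A k.+1 * p k.+1 * (q k.+1 / p k.+1) + \1_A k.+1 * p k.+1 * (F k.+1 / p k.+1) <= 1.
  rewrite (_ : _ + _ = \1_A k.+1 * (F k.+1 + q k.+1)); last first.
    by field; rewrite gt_eqF.
  by rewrite poisson_cdf_add_tail mulr1.
lra.
Qed.

Lemma poisson_massC A : poisson_mass (~` A) = 1 - poisson_mass A.
Proof.
rewrite /poisson_mass probability_setC//= -[in RHS](_ : fine 1%E = 1)//.
by rewrite -fineB// fin_num_measure.
Qed.

Lemma mass_uptoC A k : mass_upto (~` A) k = F k - mass_upto A k.
Proof.
rewrite /mass_upto /poisson_cdf -sumrB; apply: eq_bigr => j _.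
by rewrite !indicE in_setC; case: (_ \in A); rewrite /= ?mul0r ?mul1r ?subrr ?subr0.
Qed.

Lemma poisson_steinC A k : poisson_stein (~` A) k = - poisson_stein A k.
Proof.
by case: k => [|k] /=; rewrite ?oppr0// poisson_massC mass_uptoC -[RHS]mulNr; congr *%R; ring.
Qed.

Lemma norm_diff_poisson_stein_le A k : `|poisson_stein A k.+1 - poisson_stein A k| <= lam^-1.
Proof.
rewrite ler_norml diff_poisson_stein_le andbT lerNl.
have := diff_poisson_stein_le (~` A) k; rewrite !poisson_steinC; lra.
Qed.

Lemma mass_upto1 a k : mass_upto [set a] k = if (a <= k)%N then p a else 0.
Proof.
elim: k => [|k IH].
  rewrite mass_upto0 indicE leqn0; have [->|a0] := eqVneq a 0%N.
    by rewrite mem_set// mul1r.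
  by rewrite memNset ?mul0r//= => /esym/eqP; rewrite (negbTE a0).
rewrite mass_uptoS IH indicE [(a <= k.+1)%N]leq_eqVlt ltnS; have [->|ak] := eqVneq a k.+1.
  by rewrite ltnn add0r mem_set// mul1r.
by rewrite memNset ?mul0r ?addr0// => /esym/eqP; rewrite (negbTE ak).
Qed.

Lemma poisson_mass1 a : poisson_mass [set a] = p a.
Proof. by rewrite /poisson_mass /poisson_prob lam_gt0 esum_set1// lee_fin poisson_pmf_ge0. Qed.

(** For a singleton one of the two terms of [poisson_steinE] vanishes. Monotonicity of the ratio in
    the other one moves it from [k] to [a], where it is at most [q a] or [F a]. *)
Lemma norm_poisson_stein1_le a k : `|poisson_stein [set a] k| <= lam^-1.
Proof.
case: k => [|k]; first by rewrite normr0 invr_ge0 ltW.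
have p0 := poisson_pmf_gt0 lam_gt0.
have F0 := poisson_cdf_gt0 lam_gt0; have q0 := poisson_tail_gt0 lam_gt0.
rewrite -[leRHS]mul1r ler_pdivlMr// mulrC -{1}(gtr0_norm lam_gt0) -normrM poisson_steinE.
rewrite /mass_above mass_upto1 poisson_mass1; case: leqP => [ak|ka].
  rewrite subrr mul0r subr0 ger0_norm; last by rewrite mulr_ge0 ?divr_ge0// ltW.
  rewrite mulrA ler_pdivrMr// mul1r.
  have := ratio_le p0 (poisson_tail_ratio lam_gt0) ak.
  rewrite [leLHS]mulrC => /le_trans; apply; rewrite ler_piMr ?(ltW (p0 _))//.
  have := poisson_cdf_add_tail a; have := F0 a; lra.
rewrite mul0r sub0r subr0 normrN ger0_norm; last by rewrite mulr_ge0 ?divr_ge0// ltW.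
rewrite mulrA ler_pdivrMr// mul1r.
have h j : p j.+1 * F j <= F j.+1 * p j by rewrite mulrC poisson_cdf_ratio.
have := ratio_le F0 h (ltnW ka).
move=> /le_trans; apply; rewrite ler_piMl ?(ltW (p0 _))//.
have := poisson_cdf_add_tail a; have := q0 a; lra.
Qed.

End PoissonStein.

(** * Conditional laws on the integers *)

(** The integers are enumerated by their codes so that countable additivity, stated for sequences,
    applies. A fiber is empty or a singleton. *)
Definition pickle_fiber (n : nat) : set int := [set k | pickle k = n].

Lemma trivIset_pickle_fiber T (V : T -> int) :
  trivIset setT (fun n => V @^-1` pickle_fiber n).
Proof. by apply/trivIsetP => i j _ _ ij; rewrite -subset0 => w [/= wi wj]; rewrite -wi -wj eqxx in ij. Qed.

Lemma bigcup_pickle_fiber T (V : T -> int) :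
  \bigcup_n (V @^-1` pickle_fiber n) = setT.
Proof. by apply/seteqP; split => // w _; exists (pickle (V w)). Qed.

Lemma pickle_fiberP n : pickle_fiber n = set0 \/ exists k, pickle_fiber n = [set k].
Proof.
have [[k kn]|nk] := pselect (exists k : int, pickle k = n).
  right; exists k; apply/seteqP; split => [j /= jn|j ->//].
  by apply: (pcan_inj (@pickleK int)); rewrite jn.
by left; rewrite -subset0 => k kn; apply: nk; exists k.
Qed.

Section Fibers.
Context d (T : measurableType d) (R : realType) (mu : {measure set T -> \bar R}).

Lemma eq_integral_fibers (V : T -> int) (X Y : T -> R) :
  (forall k, measurable (V @^-1` [set k])) ->
  mu.-integrable setT (EFin \o X) -> mu.-integrable setT (EFin \o Y) ->
  (forall k, \int[mu]_(w in V @^-1` [set k]) (X w)%:E =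
             \int[mu]_(w in V @^-1` [set k]) (Y w)%:E)%E ->
  \int[mu]_w X w = \int[mu]_w Y w.
Proof.
move=> mV iX iY XY.
have mF n : measurable (V @^-1` pickle_fiber n).
  by have [->|[k ->]] := pickle_fiberP n; rewrite ?preimage_set0.
rewrite /Rintegral -(@bigcup_pickle_fiber _ V).
have tF := @trivIset_pickle_fiber _ V.
rewrite !integral_bigcup//; try by rewrite bigcup_pickle_fiber.
congr fine; apply: eq_eseriesr => n _.
have [->|[k ->]] := pickle_fiberP n; first by rewrite preimage_set0 !integral_set0.
exact: XY.
Qed.

Lemma measurable_fiberwise (V : T -> int) (f : int -> T -> R) :
  (forall k, measurable (V @^-1` [set k])) ->
  (forall k, measurable_fun setT (f k)) ->
  measurable_fun setT (fun w => f (V w) w).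
Proof.
move=> mV mf _ B mB; rewrite setTI.
have -> : (fun w => f (V w) w) @^-1` B =
    \bigcup_(k in [set: int]) (V @^-1` [set k] `&` f k @^-1` B).
  apply/seteqP; split => [w /= Bw|w [k _ [/= <-]]//].
  by exists (V w).
apply: countable_bigcupT_measurable => [|k]; first exact: countableP.
apply: measurableI => //.
by rewrite -[X in measurable X]setTI; exact: mf.
Qed.

(* [g] need not be measurable: the library's integral of a nonnegative function is
   a lower integral. This is applied to [smoothness], a supremum over an
   uncountable family. *)
Lemma le_lower_integral (f g : T -> \bar R) :
  (forall w, 0 <= f w)%E -> (forall w, f w <= g w)%E ->
  (\int[mu]_w f w <= \int[mu]_w g w)%E.
Proof.
move=> f0 fg; rewrite !ge0_integralTE//; last first.
  by move=> w; rewrite (le_trans (f0 w)).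
apply: le_ereal_sup => _ [h /= hf <-]; exists h => //= w.
exact: le_trans (hf w) (fg w).
Qed.

End Fibers.

Lemma bounded_integrable d (T : measurableType d) (R : realType)
    (P : probability T R) (A : set T) (f : T -> R) (B : R) :
  measurable A -> measurable_fun setT f -> (forall w, `|f w| <= B) ->
  P.-integrable A (EFin \o f).
Proof.
move=> mA mf fB; apply: (integrableS measurableT) => //.
apply: measurable_bounded_integrable => //.
  by rewrite -ge0_fin_numE ?fin_num_measure.
by exists B; split; rewrite ?num_real// => M BM w _ /=; rewrite (le_trans (fB w))// ltW.
Qed.

Lemma norm_Rintegral_le d (T : measurableType d) (R : realType)
    (P : probability T R) (f : T -> R) (B : R) :
  measurable_fun setT f -> (forall w, `|f w| <= B) -> `|\int[P]_w f w| <= B.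
Proof.
move=> mf fB; have fi := @bounded_integrable _ _ _ P _ _ _ measurableT mf fB.
apply: (le_trans (le_normr_Rintegral _ fi)) => //.
have -> : B = \int[P]_w B.
  by rewrite Rintegral_cst//= probability_setT mulr1.
apply: le_Rintegral => //; first exact: integrable_norm.
by apply: (@bounded_integrable _ _ _ _ _ _ `|B|).
Qed.

Section CondLaw.
Context d (T : measurableType d) (R : realType) (P : probability T R).
Context (F2 : set (set T)) (W : {RV P >-> int}) (K : T -> probability int R).
Hypothesis sF2 : is_sub_sigma_algebra F2.
Hypothesis WK : cond_law P F2 W K.

Definition cond_mean (r : int -> R) (w : T) : R := \int[K w]_k r k.

(** The default [0] is taken only at numbers that code no integer, where the fiber is empty. *)
Definition pickle_val (r : int -> R) (n : nat) : R :=
  odflt 0 (omap r (unpickle n)).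

Lemma pickle_valE (r : int -> R) (n : nat) k : pickle_fiber n k -> r k = pickle_val r n.
Proof. by rewrite /pickle_val => <-; rewrite pickleK. Qed.

Lemma pickle_val_ge0 (r : int -> R) (n : nat) : (forall k, 0 <= r k) -> 0 <= pickle_val r n.
Proof. by move=> r0; rewrite /pickle_val; case: unpickle => //= k. Qed.

Lemma ge0_integral_int (p : {measure set int -> \bar R}) (r : int -> R) :
  (forall k, 0 <= r k) ->
  (\int[p]_k (r k)%:E = \sum_(n <oo) (pickle_val r n)%:E * p (pickle_fiber n))%E.
Proof.
move=> r0; rewrite -(@bigcup_pickle_fiber _ id) ge0_integral_bigcup//; first last.
- exact: (@trivIset_pickle_fiber _ id).
- by move=> k _; rewrite lee_fin.
apply: eq_eseriesr => n _; rewrite preimage_id.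
rewrite -integral_cst//; apply: eq_integral => k; rewrite inE => kn.
by rewrite (pickle_valE _ kn).
Qed.

Lemma cond_law_measurable A : measurable_fun setT (fun w => K w A).
Proof.
have [_ /measurable_int mK _] := WK A.
rewrite (_ : (fun w => K w A) = EFin \o (fun w => fine (K w A)))//.
by apply/funext => w /=; rewrite fineK// fin_num_measure.
Qed.

(** Both sides are expanded over the values of [W]. Nonnegativity allows series and integral to be
    exchanged, and each term is then the defining property of [K]. *)
Lemma cond_law_ge0 (r : int -> R) (A : set T) : F2 A -> (forall k, 0 <= r k) ->
  (\int[P]_(w in A) (r (W w))%:E = \int[P]_(w in A) \int[K w]_k (r k)%:E)%E.
Proof.
move=> FA r0; have mA : measurable A by exact: sF2.2.
have c0 n : (0 <= (pickle_val r n)%:E)%E by rewrite lee_fin pickle_val_ge0.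
have mWA n : measurable (W @^-1` pickle_fiber n).
  by rewrite -[X in measurable X]setTI; exact: measurable_funPT.
transitivity (\sum_(n <oo) (pickle_val r n)%:E * P (A `&` W @^-1` pickle_fiber n))%E.
  have AE : A = \bigcup_n (A `&` W @^-1` pickle_fiber n).
    by rewrite -setI_bigcupr bigcup_pickle_fiber setIT.
  have mAW n : measurable (A `&` W @^-1` pickle_fiber n).
    exact: measurableI.
  rewrite [in LHS]AE ge0_integral_bigcup//.
  - apply: eq_eseriesr => n _; rewrite -integral_cst//.
    apply: eq_integral => w; rewrite inE => -[_ wn].
    by rewrite (pickle_valE _ wn).
  - apply/measurable_EFinP; apply: measurableT_comp => //.
    exact: measurable_funTS.
  - by move=> w _; rewrite lee_fin.
  - apply: trivIset_setIl; exact: trivIset_pickle_fiber.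
under [RHS]eq_integral do rewrite ge0_integral_int//.
rewrite integral_nneseries//; last 2 first.
- move=> n; apply: measurable_funTS; apply: emeasurable_funM => //.
  exact: cond_law_measurable.
- by move=> n w _; rewrite mule_ge0.
apply: eq_eseriesr => n _.
rewrite ge0_integralZl//; last by apply: measurable_funTS; exact: cond_law_measurable.
congr (_ * _)%E.
have [_ _ /(_ A FA) h] := WK (pickle_fiber n).
transitivity (\int[P]_(w in A) (fine (K w (pickle_fiber n)))%:E)%E; last first.
  by apply: eq_integral => w _; rewrite fineK// fin_num_measure.
by rewrite h setIC; symmetry; apply: integral_indic.
Qed.

Lemma int_integrable (p : probability int R) (r : int -> R) (B : R) :
  (forall k, `|r k| <= B) -> p.-integrable setT (EFin \o r).
Proof. by move=> rB; apply: (@bounded_integrable _ _ _ _ _ _ B). Qed.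

Lemma norm_cond_mean_le (r : int -> R) (B : R) w :
  (forall k, `|r k| <= B) -> `|cond_mean r w| <= B.
Proof. by move=> rB; exact: norm_Rintegral_le. Qed.

Lemma cond_meanE (r : int -> R) (B : R) w : (forall k, `|r k| <= B) ->
  (\int[K w]_k (r k)%:E = (cond_mean r w)%:E)%E.
Proof.
move=> rB; rewrite /cond_mean /Rintegral fineK//.
exact: integrable_fin_num (int_integrable (K w) rB).
Qed.

Lemma cond_meanD (r : int -> R) (B c : R) w : (forall k, `|r k| <= B) ->
  cond_mean (fun k => r k + c) w = cond_mean r w + c.
Proof.
move=> rB; rewrite /cond_mean RintegralD//.
- by rewrite Rintegral_cst//= probability_setT mulr1.
- exact: int_integrable rB.
- by apply: (@int_integrable _ _ `|c|).
Qed.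

Lemma cond_mean_measurable (r : int -> R) (B : R) : (forall k, `|r k| <= B) ->
  measurable_fun setT (cond_mean r).
Proof.
move=> rB.
have rB0 k : 0 <= r k + B by have := rB k; rewrite ler_norml; lra.
have rB' k : `|r k + B| <= B + B.
  by rewrite (le_trans (ler_normD _ _))// lerD// ger0_norm// (le_trans _ (rB 0)).
rewrite (_ : cond_mean r = (fun w => cond_mean (fun k => r k + B) w - B)); last first.
  by apply/funext => w; rewrite (cond_meanD _ _ rB) addrK.
apply: measurable_funB => //; apply/measurable_EFinP.
rewrite (_ : EFin \o _ =
  (fun w => \sum_(n <oo) (pickle_val (fun k => r k + B) n)%:E * K w (pickle_fiber n))%E).
  apply: ge0_emeasurable_sum => [n w _ _|n _].
    by rewrite mule_ge0// lee_fin pickle_val_ge0.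
  by apply: emeasurable_funM => //; exact: cond_law_measurable.
by apply/funext => w /=; rewrite -(cond_meanE _ rB') ge0_integral_int.
Qed.

(** Applied to the nonnegative function [r + B], the previous identity gains the finite integral of
    [B] on both sides, which cancels. *)
Lemma cond_law_bounded (r : int -> R) (B : R) (A : set T) : F2 A ->
  (forall k, `|r k| <= B) ->
  (\int[P]_(w in A) (r (W w))%:E = \int[P]_(w in A) (cond_mean r w)%:E)%E.
Proof.
move=> FA rB; have mA : measurable A by exact: sF2.2.
have rB0 k : 0 <= r k + B by have := rB k; rewrite ler_norml; lra.
have rB' k : `|r k + B| <= B + B.
  by rewrite (le_trans (ler_normD _ _))// lerD// ger0_norm// (le_trans _ (rB 0)).
have ic : P.-integrable A (EFin \o cst B) by apply: (@bounded_integrable _ _ _ _ _ _ `|B|).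
have mrW : measurable_fun setT (fun w => r (W w)) by exact: measurableT_comp.
have irW := @bounded_integrable _ _ _ P _ _ _ mA mrW (fun w => rB (W w)).
have icm := @bounded_integrable _ _ _ P _ _ _ mA (cond_mean_measurable rB) (fun w => norm_cond_mean_le w rB).
have := cond_law_ge0 FA rB0.
under [X in _ = X -> _]eq_integral do rewrite (cond_meanE _ rB') (cond_meanD _ _ rB) EFinD.
rewrite (@integralD _ _ _ P A mA (EFin \o cond_mean r) (EFin \o cst B))//.
under [X in X = _ -> _]eq_integral do rewrite EFinD.
rewrite (@integralD _ _ _ P A mA (EFin \o (r \o W)) (EFin \o cst B))//.
have fB := integrable_fin_num mA ic.
by move=> /(congr1 (fun x => x - \int[P]_(w in A) (EFin \o cst B) w)%E); rewrite !addeK.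
Qed.

(* Approximating [X] by [floor (n X) / n] reduces to the countably many
   [F2]-measurable events on which the latter is constant. *)
Lemma integral_cond_mean (X : T -> R) (r : int -> R) (B : R) :
  sub_measurable F2 X -> P.-integrable setT (EFin \o X) ->
  (forall k, `|r k| <= B) ->
  \int[P]_w (X w * r (W w)) = \int[P]_w (X w * cond_mean r w).
Proof.
move=> FX iX rB.
have B0 : 0 <= B by exact: le_trans (rB 0).
have mX : measurable_fun setT X by exact/measurable_EFinP/measurable_int/iX.
have mrW : measurable_fun setT (fun w => r (W w)) by exact: measurableT_comp.
have mcm := cond_mean_measurable rB.
have cB w := norm_cond_mean_le w rB.
pose V n w : int := Num.floor (n.+1%:R * X w).
pose Xn n w : R := (V n w)%:~R / n.+1%:R.
have XnX n w : `|X w - Xn n w| <= n.+1%:R^-1.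
  have n0 : (0 : R) < n.+1%:R by [].
  have -> : X w - Xn n w = (n.+1%:R * X w - (V n w)%:~R) / n.+1%:R.
    by rewrite /Xn; field; rewrite gt_eqF.
  rewrite normrM [X in _ * X]gtr0_norm ?invr_gt0// ler_piMl ?invr_ge0//.
  have := floor_itv (n.+1%:R * X w); rewrite -/(V n w) intrD.
  by move=> /andP[]; rewrite ler_norml; lra.
have FV n k : F2 (V n @^-1` [set k]).
  rewrite (_ : _ @^-1` _ = X @^-1` ((fun x => Num.floor (n.+1%:R * x)) @^-1` [set k]))//.
  apply: FX; rewrite (_ : _ @^-1` _ = ( *%R n.+1%:R) @^-1` `[k%:~R, (k + 1)%:~R[).
    rewrite -[X in measurable X]setTI.
    have mn : measurable_fun setT ( *%R (n.+1%:R : R)) by exact: measurable_funM.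
    by apply: mn => //; exact: measurable_itv.
  apply/seteqP; split => [x /= <-|x /=]; rewrite in_itv/=; first exact: floor_itv.
  by move=> ?; apply: floor_def.
have mV n k : measurable (V n @^-1` [set k]) by exact: sF2.2.
have mXn n : measurable_fun setT (Xn n).
  apply: (measurable_fiberwise (V := V n) (f := fun k _ => k%:~R / n.+1%:R)) => // k.
have iXn n : P.-integrable setT (EFin \o Xn n).
  have iB : P.-integrable setT (EFin \o (fun w => X w - Xn n w)).
    by apply: (@bounded_integrable _ _ _ _ _ _ n.+1%:R^-1) => //; exact: measurable_funB.
  have := integrableB measurableT iX iB; congr (integrable _ _ _).
  by apply/funext => w /=; rewrite -EFinB opprB addrC subrK.
have imul (Z f : T -> R) : P.-integrable setT (EFin \o Z) -> measurable_fun setT f ->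
    (forall w, `|f w| <= B) -> P.-integrable setT (EFin \o (fun w => Z w * f w)).
  move=> iZ mf fB; apply: (integrableMl measurableT iZ mf).
  by exists B; split; rewrite ?num_real// => M BM w _ /=; rewrite (le_trans (fB w))// ltW.
have eqn n : \int[P]_w (Xn n w * r (W w)) = \int[P]_w (Xn n w * cond_mean r w).
  apply: (eq_integral_fibers (V := V n)) => //; [exact: imul|exact: imul|].
  move=> k.
  transitivity (((k%:~R / n.+1%:R)%:E * \int[P]_(w in V n @^-1` [set k]) (r (W w))%:E)%E).
    rewrite -integralZl//; last exact: (@bounded_integrable _ _ _ _ _ _ B).
    by apply: eq_integral => w; rewrite inE /Xn => ->.
  rewrite (cond_law_bounded (FV n k) rB) -integralZl//; last exact: (@bounded_integrable _ _ _ _ _ _ B).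
  by apply: eq_integral => w; rewrite inE /Xn => ->.
have close n (f : T -> R) : measurable_fun setT f -> (forall w, `|f w| <= B) ->
    `|\int[P]_w (X w * f w) - \int[P]_w (Xn n w * f w)| <= B / n.+1%:R.
  move=> mf fB; rewrite -RintegralB//; [|exact: imul|exact: imul].
  under eq_Rintegral do rewrite -mulrBl.
  apply: norm_Rintegral_le.
    by apply: measurable_funM => //; exact: measurable_funB.
  by move=> w; rewrite normrM mulrC ler_pM.
set a := \int[P]_w (X w * r (W w)); set b := \int[P]_w (X w * cond_mean r w).
have ab n : `|a - b| * n.+1%:R <= 2 * B.
  rewrite -ler_pdivlMr// (_ : a - b = (a - \int[P]_w (Xn n w * r (W w))) -
    (b - \int[P]_w (Xn n w * cond_mean r w))); last by rewrite eqn; ring.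
  rewrite (le_trans (ler_normB _ _))// mulr_natl mulrDl.
  by rewrite lerD// close.
apply/eqP; rewrite -subr_eq0 -normr_eq0 -[_ == 0]negbK; apply/negP => ab0.
have abgt0 : 0 < `|a - b| by rewrite lt0r ab0 normr_ge0.
have := ab (Num.truncn (2 * B / `|a - b|)).
by rewrite mulrC -ler_pdivlMr// leNgt truncnS_gt.
Qed.

End CondLaw.

(** * Newton remainder and smoothness *)

Section Smoothness.
Context (R : realType) (p : probability int R).

Lemma iter2_forward_diffE (h : int -> R) k :
  iter 2 (@forward_diff R) h k = h (k + 1 + 1) - h (k + 1) - (h (k + 1) - h k).
Proof. by []. Qed.

Lemma norm_iter2_forward_diff (h : int -> R) (B : R) k : (forall j, `|h j| <= B) ->
  `|iter 2 (@forward_diff R) h k| <= 4 * B.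
Proof.
move=> hB; rewrite iter2_forward_diffE.
have := hB (k + 1 + 1); have := hB (k + 1); have := hB k.
rewrite !ler_norml; lra.
Qed.

Lemma smoothness2_ge0 : (0 <= smoothness 2 p)%E.
Proof.
apply: (le_trans _ (ereal_sup_ubound _)); last first.
  by exists (fun=> 0 : R) => //= k; rewrite normr0.
exact: abse_ge0.
Qed.

Lemma smoothness2_fin_num : smoothness 2 p \is a fin_num.
Proof.
rewrite ge0_fin_numE ?smoothness2_ge0//; apply: (@le_lt_trans _ _ (4 : R)%:E); last exact: ltry.
apply: ge_ereal_sup => _ [h /= hB <-]; rewrite unlock.
have h4 k : `|iter 2 (@forward_diff R) h k| <= 4.
  by have := norm_iter2_forward_diff k hB; rewrite mulr1.
rewrite -EFin_normr_Rintegral//; last exact: (int_integrable p h4).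
by rewrite lee_fin norm_Rintegral_le.
Qed.

Lemma smoothness2_le (h : int -> R) (B : R) : 0 < B -> (forall k, `|h k| <= B) ->
  `|\int[p]_k iter 2 (@forward_diff R) h k| <= B * fine (smoothness 2 p).
Proof.
move=> B0 hB.
have h4 k := norm_iter2_forward_diff k hB.
have ih := int_integrable p h4.
rewrite mulrC -ler_pdivrMr// -lee_fin fineK ?smoothness2_fin_num//.
apply: ereal_sup_ubound; exists (fun k => h k / B).
  by move=> k /=; rewrite normrM [X in _ * X]gtr0_norm ?invr_gt0// ler_pdivrMr// mul1r.
rewrite unlock.
have -> : (\int[p]_w (iter 2 (@forward_diff R) (fun k => h k / B) w)%:E =
    \int[p]_w (iter 2 (@forward_diff R) h w / B)%:E)%E.
  by apply: eq_integral => k _; congr EFin; rewrite !iter2_forward_diffE; ring.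
rewrite -EFin_normr_Rintegral//; last first.
  apply: (@int_integrable _ p _ (4 * B / B)) => k.
  by rewrite normrM [X in _ * X]gtr0_norm ?invr_gt0// ler_pM2r// invr_gt0.
by rewrite RintegralZr// normrM [X in _ * X]gtr0_norm// invr_gt0.
Qed.

Definition newton_rem (g : int -> R) (d k : int) : R :=
  g (k + d) - g k - d%:~R * forward_diff g k.

Lemma norm_newton_rem_le (g : int -> R) (B : R) d k : (forall j, `|g j| <= B) ->
  `|newton_rem g d k| <= 2 * B + `|d%:~R| * (2 * B).
Proof.
move=> gB; rewrite (le_trans (ler_normB _ _))// normrM.
have fB j i : `|g j - g i| <= 2 * B.
  by have := gB i; have := gB j; rewrite !ler_norml; lra.
by rewrite lerD// ler_wpM2l// fB.
Qed.

(** Raising [d] by one adds [dl d] to the remainder, and the mean of [dl d] telescopes into [|d|]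
    second differences of shifts of [g]. Upwards from [0] the counts are [0, ..., n - 1], downwards
    they are [1, ..., n]; both add up to [d (d - 1) / 2], which explains the asymmetric factor. *)
Lemma mean_newton_rem_le (g : int -> R) (B : R) (d : int) : 0 < B ->
  (forall k, `|g k| <= B) ->
  `|\int[p]_k newton_rem g d k| <=
    B / 2 * ((d%:~R * (d%:~R - 1)) * fine (smoothness 2 p)).
Proof.
move=> B0 gB; set s := fine _.
have s0 : 0 <= s by rewrite fine_ge0// smoothness2_ge0.
pose dl (d k : int) : R := forward_diff g (k + d) - forward_diff g k.
have dB e k : `|dl e k| <= 4 * B.
  rewrite /dl /forward_diff.
  have := gB (k + e + 1); have := gB (k + e); have := gB (k + 1); have := gB k.
  rewrite !ler_norml; lra.
have idl e := int_integrable p (dB e).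
have irem e := int_integrable p (fun k => norm_newton_rem_le e k gB).
have dlS e : `|\int[p]_k dl (e + 1) k - \int[p]_k dl e k| <= B * s.
  rewrite -RintegralB//.
  have := smoothness2_le (h := fun k => g (k + e)) B0 (fun k => gB _).
  congr (`| _ | <= _); apply: eq_Rintegral => k _.
  have e1 : k + (e + 1) = k + 1 + e by ring.
  have e2 : k + (e + 1) + 1 = k + 1 + 1 + e by ring.
  have e3 : k + e + 1 = k + 1 + e by ring.
  by rewrite iter2_forward_diffE /dl /forward_diff e2 e1 e3; ring.
have int0 (f : int -> R) : (forall k, f k = 0) -> \int[p]_k f k = 0.
  by move=> f0; under eq_Rintegral do rewrite f0; rewrite Rintegral_cst// mul0r.
have dl0 : \int[p]_k dl 0 k = 0.
  by apply: int0 => k; rewrite /dl addr0 subrr.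
have dl_pos (n : nat) : `|\int[p]_k dl n%:Z k| <= n%:R * (B * s).
  elim: n => [|n IH]; first by rewrite dl0 normr0 mul0r.
  have := dlS n%:Z; rewrite -natr1 mulrDl mul1r -addn1 PoszD.
  have := ler_normD (\int[p]_k dl (n%:Z + 1) k - \int[p]_k dl n%:Z k) (\int[p]_k dl n%:Z k).
  rewrite subrK; lra.
have dl_neg (n : nat) : `|\int[p]_k dl (- n%:Z) k| <= n%:R * (B * s).
  elim: n => [|n IH]; first by rewrite oppr0 dl0 normr0 mul0r.
  have := dlS (- n.+1%:Z); rewrite -[n.+1%:R]natr1 mulrDl mul1r.
  have -> : - n.+1%:Z + 1 = - n%:Z by rewrite -addn1 PoszD; ring.
  have := ler_normB (\int[p]_k dl (- n%:Z) k) (\int[p]_k dl (- n%:Z) k - \int[p]_k dl (- n.+1%:Z) k).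
  rewrite opprB addrC subrK; lra.
have remS e k : newton_rem g (e + 1) k = newton_rem g e k + dl e k.
  rewrite /newton_rem /dl /forward_diff intrD.
  have -> : k + (e + 1) = k + e + 1 by ring.
  by ring.
have remS' e : \int[p]_k newton_rem g (e + 1) k = \int[p]_k newton_rem g e k + \int[p]_k dl e k.
  by rewrite -RintegralD//; apply: eq_Rintegral => k _; exact: remS.
have rem0 : \int[p]_k newton_rem g 0 k = 0.
  by apply: int0 => k; rewrite /newton_rem addr0 subrr mul0r subrr.
case: d => n.
  elim: n => [|n IH]; first by rewrite rem0 normr0 !mul0r mulr0.
  rewrite -addn1 PoszD remS' (le_trans (ler_normD _ _))//.
  apply: (le_trans (lerD IH (dl_pos n))).
  by rewrite le_eqVlt; apply/orP; left; apply/eqP; rewrite intrD; field.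
rewrite NegzE; elim: n => [|n IH].
  have := remS' (-1); rewrite addNr rem0 => /eqP; rewrite eq_sym addr_eq0 => /eqP ->.
  rewrite normrN (le_trans (dl_neg 1))// le_eqVlt; apply/orP; left; apply/eqP; by rewrite intrN; field.
have := remS' (- n.+2%:Z).
have -> : - n.+2%:Z + 1 = - n.+1%:Z by rewrite -[n.+2]addn1 PoszD; ring.
move=> /eqP; rewrite -subr_eq => /eqP <-.
rewrite (le_trans (ler_normB _ _))//.
apply: (le_trans (lerD IH (dl_neg n.+2))).
rewrite le_eqVlt; apply/orP; left; apply/eqP.
by rewrite -[n.+2]addn1 PoszD !intrN intrD natrD; field.
Qed.

End Smoothness.

(** A bound proportional to [|d|] is what lets the integrability of [G * D] dominate [G] times the
    remainder. *)
Lemma norm_newton_rem_le_step (R : realType) (g : int -> R) (B : R) d k :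
  (forall j, `|g j| <= B) -> `|newton_rem g d k| <= 4 * B * `|d%:~R|.
Proof.
move=> gB; have B0 : 0 <= B by exact: le_trans (gB 0).
have [->|d0] := eqVneq d 0.
  by rewrite /newton_rem addr0 subrr mul0r subrr normr0 mulr0.
have d1 : 1 <= `|d%:~R : R|.
  by rewrite -intr_norm -[1]/(1%:~R) ler_int; move: d0; rewrite -normr_gt0 -gtz0_ge1.
rewrite (le_trans (norm_newton_rem_le d k gB))//.
have := ler_wpM2r B0 d1; lra.
Qed.

(** * The coupling remainder, conditionally on [F2] *)

Section Remainder.
Context d (T : measurableType d) (R : realType) (P : probability T R).
Context (F2 : set (set T)) (W : {RV P >-> int}) (K : T -> probability int R).
Context (G : T -> R) (D : T -> int).
Hypothesis sF2 : is_sub_sigma_algebra F2.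
Hypothesis WK : cond_law P F2 W K.
Hypothesis FGD : sub_measurable F2 (fun w => (G w, D w)).
Hypothesis iGD : P.-integrable setT (fun w => (G w * (D w)%:~R)%:E).

Lemma measurable_weight : measurable_fun setT G.
Proof.
move=> _ B mB; rewrite setTI; apply: sF2.2.
rewrite (_ : G @^-1` B = (fun w => (G w, D w)) @^-1` (fst @^-1` B))//.
by apply: FGD; rewrite -[X in measurable X]setTI; exact: measurable_fst.
Qed.

Lemma measurable_step k : measurable (D @^-1` [set k]).
Proof.
apply: sF2.2.
rewrite (_ : _ @^-1` _ = (fun w => (G w, D w)) @^-1` (snd @^-1` [set k]))//.
by apply: FGD; rewrite -[X in measurable X]setTI; exact: measurable_snd.
Qed.

Lemma measurable_step_fun (f : int -> R) : measurable_fun setT (fun w => f (D w)).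
Proof.
by apply: (measurable_fiberwise (f := fun k _ => f k)) => //; exact: measurable_step.
Qed.

Lemma weight_step_integrable (f : T -> R) (B : R) : measurable_fun setT f ->
  (forall w, `|f w| <= B * `|(D w)%:~R|) ->
  P.-integrable setT (EFin \o (fun w => G w * f w)).
Proof.
move=> mf fB.
apply: (le_integrable measurableT _ _ (integrableZl measurableT B iGD)).
  by apply/measurable_EFinP; apply: measurable_funM => //; exact: measurable_weight.
move=> w _; rewrite /= lee_fin !normrM [in leRHS]mulrCA ler_wpM2l//.
by rewrite (le_trans (fB w))// ler_wpM2r// ler_norm.
Qed.

Lemma sub_measurable_weight_step k :
  sub_measurable F2 (fun w => G w * (D w == k)%:R).
Proof.
move=> B mB; pose f (x : R * int) : R := x.1 * (x.2 == k)%:R.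
rewrite (_ : _ @^-1` B = (fun w => (G w, D w)) @^-1` (f @^-1` B))//.
apply: FGD; rewrite -[X in measurable X]setTI.
have mf : measurable_fun setT f.
  apply: measurable_funM; first exact: measurable_fst.
  have m2 : measurable_fun setT (fun j : int => (j == k)%:R : R) by [].
  exact: (measurableT_comp m2 (@measurable_snd _ _ _ _)).
exact: mf.
Qed.

(** [cond_mean] is controlled for a fixed function of [W], whereas the remainder also depends on
    [D]. The identity is therefore proved on each event [D = k], where the weight [G * (D == k)] is
    [F2]-measurable. *)
Lemma newton_rem_cond_mean (g : int -> R) (B : R) : (forall k, `|g k| <= B) ->
  \int[P]_w (G w * newton_rem g (D w) (W w)) =
  \int[P]_w (G w * cond_mean K (newton_rem g (D w)) w).
Proof.
move=> gB.
have remB k j := norm_newton_rem_le k j gB.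
have mW : measurable_fun setT W by [].
have m1 : measurable_fun setT (fun w => newton_rem g (D w) (W w)).
  apply: (measurable_fiberwise (f := fun k w => newton_rem g k (W w))) => k.
    exact: measurable_step.
  exact: measurableT_comp.
have m2 : measurable_fun setT (fun w => cond_mean K (newton_rem g (D w)) w).
  apply: (measurable_fiberwise (f := fun k w => cond_mean K (newton_rem g k) w)) => k.
    exact: measurable_step.
  exact: (cond_mean_measurable WK (remB k)).
apply: (eq_integral_fibers (V := D)) => [k|||k].
- exact: measurable_step.
- by apply: (weight_step_integrable (B := 4 * B)) => // w; exact: norm_newton_rem_le_step.
- apply: (weight_step_integrable (B := 4 * B)) => // w.
  by apply: norm_cond_mean_le => j; exact: norm_newton_rem_le_step.
have mDk := measurable_step k.
(* On [D = 0] the weight [G] may fail to be integrable, but the remainder vanishes. For [k <> 0] the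
   indicator is at most [|D|], so [X] is dominated by [G * D]. *)
have [k0|k0] := eqVneq k 0.
  have r0 j : newton_rem g 0 j = 0 by rewrite /newton_rem addr0 subrr mul0r subrr.
  apply: eq_integral => w; rewrite inE /= => ->; rewrite k0 r0 /cond_mean.
  under eq_Rintegral do rewrite r0.
  by rewrite Rintegral_cst// mul0r.
pose X w := G w * (D w == k)%:R.
have iX : P.-integrable setT (EFin \o X).
  apply: (weight_step_integrable (f := fun w => (D w == k)%:R) (B := 1)) => [|w].
    exact: (measurable_step_fun (fun j => (j == k)%:R)).
  have [->|] := eqVneq (D w) k; last by rewrite normr0 mul1r.
  by rewrite mul1r normr1 -intr_norm -[1]/(1%:~R) ler_int; move: k0; rewrite -normr_gt0 -gtz0_ge1.
have fiberE (f : T -> R) : measurable_fun setT f -> (forall w, `|f w| <= 2 * B + `|k%:~R| * (2 * B)) ->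
    (\int[P]_w (X w * f w))%:E = (\int[P]_(w in D @^-1` [set k]) (G w * f w)%:E)%E.
  move=> mf fB.
  rewrite /Rintegral fineK; last first.
    apply: (integrable_fin_num measurableT); apply: (integrableMl measurableT iX mf).
    exists (2 * B + `|k%:~R| * (2 * B)); split; rewrite ?num_real// => M BM w _ /=.
    by rewrite (le_trans (fB w))// ltW.
  rewrite [RHS]integral_mkcond; apply: eq_integral => w _; rewrite patchE.
  rewrite /X; case: ifPn => [|]; first by rewrite inE /= => ->; rewrite eqxx mulr1.
  by rewrite notin_setE /= => /eqP/negbTE ->; rewrite mulr0 mul0r.
have mWk : measurable_fun setT (fun w => newton_rem g k (W w)) by exact: measurableT_comp.
transitivity (\int[P]_w (X w * newton_rem g k (W w)))%:E.
  rewrite fiberE; [|exact: mWk|by move=> w; exact: remB].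
  by apply: eq_integral => w; rewrite inE /= => ->.
rewrite (integral_cond_mean sF2 WK (sub_measurable_weight_step k) iX (remB k)).
rewrite fiberE; last 2 first.
- exact: (cond_mean_measurable WK (remB k)).
- by move=> w; apply: norm_cond_mean_le => j; exact: remB.
by apply: eq_integral => w; rewrite inE /= => ->.
Qed.

Lemma newton_rem_expectation_le (g : int -> R) (B : R) : 0 < B -> (forall k, `|g k| <= B) ->
  (`|\int[P]_w (G w * newton_rem g (D w) (W w))|%:E <= (B / 2)%:E *
   \int[P]_w (`|G w * (D w)%:~R * ((D w)%:~R - 1)|%:E * smoothness 2 (K w)))%E.
Proof.
move=> B0 gB; rewrite (newton_rem_cond_mean gB).
have m2 : measurable_fun setT (fun w => cond_mean K (newton_rem g (D w)) w).
  apply: (measurable_fiberwise (f := fun k w => cond_mean K (newton_rem g k) w)) => k.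
    exact: measurable_step.
  exact: (cond_mean_measurable WK (fun j => norm_newton_rem_le k j gB)).
have i2 : P.-integrable setT (EFin \o (fun w => G w * cond_mean K (newton_rem g (D w)) w)).
  apply: (weight_step_integrable (B := 4 * B)) => // w.
  by apply: norm_cond_mean_le => j; exact: norm_newton_rem_le_step.
have B2 : 0 < B / 2 by rewrite divr_gt0.
apply: (@le_trans _ _ (\int[P]_w `|G w * cond_mean K (newton_rem g (D w)) w|)%:E).
  by rewrite lee_fin; exact: le_normr_Rintegral.
rewrite /Rintegral fineK; last exact: integrable_fin_num (integrable_norm i2).
(* The factor [B / 2] moves to the left, where the integrand is measurable and can be scaled; on the
   right only monotonicity of the lower integral is used. *)
rewrite muleC -lee_pdivrMr//.
rewrite -ge0_integralZr//=; last 2 first.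
- by apply/measurable_EFinP; apply: measurableT_comp => //; apply/measurable_EFinP/measurable_int/i2.
- by rewrite lee_fin invr_ge0 ltW.
apply: le_lower_integral => [w|w].
  by rewrite mule_ge0// lee_fin invr_ge0 ltW.
rewrite -[smoothness 2 _]fineK ?smoothness2_fin_num// -!EFinM lee_fin ler_pdivrMr//.
have s0 : 0 <= fine (smoothness 2 (K w)) by rewrite fine_ge0// smoothness2_ge0.
rewrite (_ : _ * (B / 2) = `|G w| * (B / 2 * (`|(D w)%:~R * ((D w)%:~R - 1)| *
  fine (smoothness 2 (K w))))); last by rewrite -[G w * _ * _]mulrA normrM; ring.
rewrite normrM ler_wpM2l//.
apply: (le_trans (mean_newton_rem_le (K w) (D w) B0 gB)).
by rewrite ler_wpM2l ?(ltW B2)// ler_wpM2r// ler_norm.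
Qed.

End Remainder.

(** * Stein couplings *)

Section Integrals.
Context d (T : measurableType d) (R : realType) (P : probability T R).
Local Notation intble f := (P.-integrable setT (EFin \o f)).

Lemma integrable_mul_bounded (f g : T -> R) (B : R) : intble f ->
  measurable_fun setT g -> (forall w, `|g w| <= B) -> intble (fun w => f w * g w).
Proof.
move=> fi mg gB; apply: (integrableMl measurableT fi mg).
by exists B; split; rewrite ?num_real// => M BM w _ /=; rewrite (le_trans (gB w))// ltW.
Qed.

Lemma intble_measurable (f : T -> R) : intble f -> measurable_fun setT f.
Proof. by move=> fi; exact/measurable_EFinP/measurable_int/fi. Qed.

Lemma intble_EFin (f : T -> R) : intble f ->
  (\int[P]_w (f w)%:E = (\int[P]_w f w)%:E)%E.
Proof. by move=> fi; rewrite /Rintegral fineK//; exact: integrable_fin_num. Qed.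

Lemma integrable_prod_of_sqr (f g : T -> R) :
  measurable_fun setT f -> measurable_fun setT g ->
  intble (fun w => f w ^+ 2) -> intble (fun w => g w ^+ 2) ->
  intble (fun w => f w * g w).
Proof.
move=> mf mg f2 g2; apply: (le_integrable measurableT _ _ (integrableD measurableT f2 g2)).
  by apply/measurable_EFinP; exact: measurable_funM.
move=> w _; rewrite /= lee_fin normrM [leRHS]ger0_norm ?addr_ge0 ?sqr_ge0//.
have := sqr_ge0 (`|f w| - `|g w|); rewrite -[f w ^+ 2]real_normK ?num_real//.
rewrite -[g w ^+ 2]real_normK ?num_real//.
have := normr_ge0 (f w); have := normr_ge0 (g w); nra.
Qed.

Lemma cauchy_schwarz (f g : T -> R) :
  measurable_fun setT f -> measurable_fun setT g ->
  intble (fun w => f w ^+ 2) -> intble (fun w => g w ^+ 2) ->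
  \int[P]_w `|f w * g w| <=
    Num.sqrt (\int[P]_w f w ^+ 2) * Num.sqrt (\int[P]_w g w ^+ 2).
Proof.
move=> mf mg f2 g2; have fg := integrable_prod_of_sqr mf mg f2 g2.
have fg' := integrable_norm fg.
set A := \int[P]_w f w ^+ 2; set C := \int[P]_w g w ^+ 2.
set B := \int[P]_w `|f w * g w|.
have A0 : 0 <= A by apply: Rintegral_ge0 => w _; exact: sqr_ge0.
have C0 : 0 <= C by apply: Rintegral_ge0 => w _; exact: sqr_ge0.
have B0 : 0 <= B by exact: Rintegral_ge0.
have key (t : R) : 0 <= A - 2 * t * B + t ^+ 2 * C.
  have i1 : intble (fun w => (2 * t) * `|f w * g w|).
    exact: (integrableZl measurableT (2 * t) fg').
  have i2 : intble (fun w => t ^+ 2 * g w ^+ 2).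
    exact: (integrableZl measurableT (t ^+ 2) g2).
  have -> : A - 2 * t * B + t ^+ 2 * C =
      \int[P]_w (f w ^+ 2 - (2 * t) * `|f w * g w| + t ^+ 2 * g w ^+ 2).
    rewrite RintegralD//; last exact: (integrableB measurableT f2 i1).
    by rewrite RintegralB// !RintegralZl.
  apply: Rintegral_ge0 => w _.
  have -> : f w ^+ 2 - 2 * t * `|f w * g w| + t ^+ 2 * g w ^+ 2 = (`|f w| - t * `|g w|) ^+ 2.
    rewrite sqrrB !exprMn !real_normK ?num_real// normrM mulr2n; ring.
  exact: sqr_ge0.
rewrite -sqrtrM// -[leLHS](ger0_norm B0) -sqrtr_sqr ler_sqrt ?mulr_ge0//.
(* For [C > 0] the minimiser [t = B / C] of the quadratic in [key] gives the claim. For [C = 0] the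
   quadratic is affine, and unless [B = 0] the choice [t = (A + 1) / (2 B)] would give it the value
   [-1]. *)
have [C0'|C0'] := eqVneq C 0.
  have := key ((A + 1) / (2 * B)); rewrite C0' !mulr0 addr0.
  have [->|Bn0] := eqVneq B 0; first by rewrite expr0n.
  have -> : A - 2 * ((A + 1) / (2 * B)) * B = -1 by field.
  by rewrite ler0N1.
have Cp : 0 < C by rewrite lt0r C0'.
have := key (B / C); have -> : A - 2 * (B / C) * B + (B / C) ^+ 2 * C = (A * C - B ^+ 2) / C.
  by field.
by rewrite pmulr_lge0 ?invr_gt0// subr_ge0.
Qed.

End Integrals.

(** * The coupling identity and its estimate *)

Section Coupling.
Context d (T : measurableType d) (R : realType) (P : probability T R).
Context (mu sigma : R) (W W' : {RV P >-> int}) (G Rm : {RV P >-> R}).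
Context (F1 F2 : set (set T)) (Y : T -> R) (K : T -> probability int R).
Local Notation intble f := (P.-integrable setT (EFin \o f)).
Hypothesis coupling : approx_stein_coupling mu W W' G Rm.
Hypothesis sigma_gt0 : 0 < sigma.
Hypothesis varW : ('V_P[fun w => (W w)%:~R] = (sigma ^+ 2)%:E)%E.
Let D (w : T) : int := W' w - W w.
Hypothesis sF1 : is_sub_sigma_algebra F1.
Hypothesis sF2 : is_sub_sigma_algebra F2.
Hypothesis F1W : sub_measurable F1 W.
Hypothesis F2GD : sub_measurable F2 (fun w => (G w, D w)).
Let GD (w : T) : R := G w * (D w)%:~R.
Hypothesis YGD : cond_expectation P F1 GD Y.
Hypothesis KW : cond_law P F2 W K.
Let X (w : T) : R := (W w)%:~R - mu.
Let Psi (w : T) : R := `|Y w - fine ('E_P[GD])%E|.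
Let Upsilon : \bar R :=
  (\int[P]_w (`|G w * (D w)%:~R * ((D w)%:~R - 1)|%:E * smoothness 2 (K w)))%E.

Lemma measurable_RVint (f : int -> R) : measurable_fun setT (fun w => f (W w)).
Proof. exact: measurableT_comp. Qed.

Lemma expectation_sqr_centered : (\int[P]_w (X w ^+ 2)%:E = (sigma ^+ 2)%:E)%E.
Proof.
have [EW _ _] := coupling.
rewrite -varW /variance !unlock; apply: eq_integral => w _.
by rewrite /X expr2; move: EW; rewrite unlock => ->.
Qed.

Lemma integrable_sqr_centered : intble (fun w => X w ^+ 2).
Proof.
apply/integrableP; split; first by apply/measurable_EFinP; exact: (measurable_RVint (fun k => (k%:~R - mu) ^+ 2)).
under eq_integral => w _ do rewrite /= ger0_norm ?sqr_ge0//.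
by rewrite expectation_sqr_centered ltry.
Qed.

Lemma Rintegral_sqr_centered : \int[P]_w X w ^+ 2 = sigma ^+ 2.
Proof. by rewrite /Rintegral expectation_sqr_centered. Qed.

Lemma measurable_centered : measurable_fun setT X.
Proof. exact: (measurable_RVint (fun k => k%:~R - mu)). Qed.

Lemma intble_cst (c : R) : intble (fun=> c).
Proof. by apply: (@bounded_integrable _ _ _ _ _ _ `|c|). Qed.

Lemma intble_of_sqr (f : T -> R) : measurable_fun setT f ->
  intble (fun w => f w ^+ 2) -> intble f.
Proof.
move=> mf f2.
have h1 : intble (fun=> (1 : R) ^+ 2) := intble_cst (1 ^+ 2).
have := integrable_prod_of_sqr mf (@measurable_cst _ _ _ _ _ (1 : R)) f2 h1.
by congr (integrable _ _ _); apply/funext => w /=; rewrite mulr1.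
Qed.

Lemma mean_norm_le_sqrt (f : T -> R) : measurable_fun setT f ->
  intble (fun w => f w ^+ 2) ->
  \int[P]_w `|f w| <= Num.sqrt (\int[P]_w f w ^+ 2).
Proof.
move=> mf f2; have h1 : intble (fun=> (1 : R) ^+ 2) := intble_cst (1 ^+ 2).
have := cauchy_schwarz mf (@measurable_cst _ _ _ _ _ (1 : R)) f2 h1.
have -> : \int[P]_w (cst 1 w : R) ^+ 2 = 1.
  under eq_Rintegral do rewrite /= expr1n.
  by rewrite Rintegral_cst//= probability_setT mul1r.
rewrite sqrtr1 mulr1; congr (_ <= _).
by apply: eq_Rintegral => w _; rewrite /= mulr1.
Qed.

Lemma intble_centered : intble X.
Proof. exact: intble_of_sqr measurable_centered integrable_sqr_centered. Qed.

Lemma mean_norm_centered : \int[P]_w `|X w| <= sigma.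
Proof.
have := mean_norm_le_sqrt measurable_centered integrable_sqr_centered.
by rewrite Rintegral_sqr_centered sqrtr_sqr gtr0_norm.
Qed.

Hypothesis iR2 : intble (fun w => Rm w ^+ 2).
Let r : R := Num.sqrt (\int[P]_w Rm w ^+ 2).

Let mR : measurable_fun setT Rm. Proof. by []. Qed.

Lemma intble_remainder : intble Rm.
Proof. exact: intble_of_sqr. Qed.

Lemma intble_remainder_centered : intble (fun w => Rm w * X w).
Proof. exact: integrable_prod_of_sqr mR measurable_centered iR2 integrable_sqr_centered. Qed.

Lemma mean_remainder_centered : `|\int[P]_w (Rm w * X w)| <= r * sigma.
Proof.
rewrite (le_trans (le_normr_Rintegral _ intble_remainder_centered))//.
have := cauchy_schwarz mR measurable_centered iR2 integrable_sqr_centered.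
by rewrite Rintegral_sqr_centered sqrtr_sqr [`|sigma|]gtr0_norm.
Qed.

Lemma intble_GD : intble GD.
Proof. by have [] := coupling. Qed.

Lemma coupling_Rintegral (f : int -> R) :
  intble (fun w => G w * (f (W' w) - f (W w))) -> intble (fun w => X w * f (W w)) ->
  intble (fun w => Rm w * f (W w)) ->
  \int[P]_w (G w * (f (W' w) - f (W w))) =
  \int[P]_w (X w * f (W w)) + \int[P]_w (Rm w * f (W w)).
Proof.
move=> i1 i2 i3; have [_ _ /(_ f i1 i2 i3)] := coupling.
rewrite !unlock !intble_EFin// => -[]//.
Qed.

Lemma mean_GD : \int[P]_w GD w = sigma ^+ 2 + \int[P]_w (Rm w * X w).
Proof.
have e w : G w * ((W' w)%:~R - mu - ((W w)%:~R - mu)) = GD w.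
  by rewrite /GD /D intrB; congr (_ * _); ring.
rewrite -Rintegral_sqr_centered.
have := coupling_Rintegral (f := fun k => k%:~R - mu).
under eq_Rintegral do rewrite e.
have -> : (fun w => G w * ((W' w)%:~R - mu - ((W w)%:~R - mu))) = GD by apply/funext.
move=> ->//; last exact: intble_remainder_centered.
exact: intble_GD.
exact: integrable_sqr_centered.
Qed.

Lemma intble_Y : intble Y. Proof. by have [] := YGD. Qed.

(* As [W] takes countably many values, conditioning on [F1] only enters
   through the events [W = k]. *)
Lemma mean_GD_fun (f : int -> R) (B : R) : (forall k, `|f k| <= B) ->
  \int[P]_w (GD w * f (W w)) = \int[P]_w (Y w * f (W w)).
Proof.
move=> fB.
have iG : intble (fun w => GD w * f (W w)).
  by apply: (integrable_mul_bounded intble_GD (measurable_RVint f)) => w; exact: fB.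
have iY : intble (fun w => Y w * f (W w)).
  by apply: (integrable_mul_bounded intble_Y (measurable_RVint f)) => w; exact: fB.
have F1k k : F1 (W @^-1` [set k]) by exact: F1W.
apply: (eq_integral_fibers (V := W)) => // k; first exact: sF1.2.
have mk : measurable (W @^-1` [set k]) by exact: sF1.2.
transitivity ((f k)%:E * \int[P]_(w in W @^-1` [set k]) (GD w)%:E)%E.
  rewrite -integralZl//; last exact: (integrableS measurableT mk _ intble_GD).
  by apply: eq_integral => w; rewrite inE /= => ->; rewrite mulrC.
have [_ _ <-//] := YGD.
rewrite -integralZl//; last exact: (integrableS measurableT mk _ intble_Y).
by apply: eq_integral => w; rewrite inE /= => ->; rewrite mulrC.
Qed.

Lemma intble_Psi : intble Psi.
Proof. exact: (integrable_norm (integrableB measurableT intble_Y (intble_cst _))). Qed.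

Lemma fine_mean_GD : fine ('E_P[GD])%E = \int[P]_w GD w.
Proof. by rewrite unlock. Qed.

(** Splitting [Y] around [E GD] leaves the product of [E GD] and the mean of [Delta g(W)]. Inserting
    [E GD = sigma^2 + E R X] produces a Stein operator with [sigma^2] in place of [lam], and the
    second error term. *)
Lemma coupling_expansion (g : int -> R) (B : R) : 0 < B -> (forall k, `|g k| <= B) ->
  sigma ^+ 2 * \int[P]_w forward_diff g (W w) - \int[P]_w (X w * g (W w)) =
  - (\int[P]_w ((Y w - \int[P]_w GD w) * forward_diff g (W w)))
  - \int[P]_w (Rm w * X w) * \int[P]_w forward_diff g (W w)
  - \int[P]_w (G w * newton_rem g (D w) (W w)) + \int[P]_w (Rm w * g (W w)).
Proof.
move=> B0 gB.
have dgB k : `|forward_diff g k| <= 2 * B.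
  by rewrite /forward_diff; have := gB (k + 1); have := gB k; rewrite !ler_norml; lra.
have mdg := measurable_RVint (forward_diff g).
have mg := measurable_RVint g.
have iGdg : intble (fun w => GD w * forward_diff g (W w)).
  by apply: (integrable_mul_bounded intble_GD mdg) => w; exact: dgB.
have iYdg : intble (fun w => Y w * forward_diff g (W w)).
  by apply: (integrable_mul_bounded intble_Y mdg) => w; exact: dgB.
have iXg : intble (fun w => X w * g (W w)).
  by apply: (integrable_mul_bounded intble_centered mg) => w; exact: gB.
have iRg : intble (fun w => Rm w * g (W w)).
  by apply: (integrable_mul_bounded intble_remainder mg) => w; exact: gB.
have idg : intble (fun w => forward_diff g (W w)).
  by apply: (@bounded_integrable _ _ _ _ _ _ (2 * B)).
have irem : intble (fun w => G w * newton_rem g (D w) (W w)).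
  apply: (@weight_step_integrable _ _ _ P F2 G D sF2 F2GD intble_GD _ (4 * B)).
    apply: (measurable_fiberwise (V := D) (f := fun k w => newton_rem g k (W w))) => k.
      exact: (measurable_step sF2 F2GD).
    exact: measurable_RVint.
  by move=> w; exact: norm_newton_rem_le_step.
have e w : G w * (g (W' w) - g (W w)) =
    GD w * forward_diff g (W w) + G w * newton_rem g (D w) (W w).
  by rewrite /newton_rem (_ : W w + D w = W' w) /GD ?/D; ring.
have := coupling_Rintegral (f := g).
under eq_Rintegral do rewrite e.
rewrite (_ : (fun w => G w * _) = (fun w => GD w * forward_diff g (W w) +
    G w * newton_rem g (D w) (W w))); last by apply/funext.
move=> /(_ (integrableD measurableT iGdg irem) iXg iRg).
rewrite RintegralD// (mean_GD_fun dgB).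
have -> : \int[P]_w (Y w * forward_diff g (W w)) =
    \int[P]_w ((Y w - \int[P]_w GD w) * forward_diff g (W w)) +
    (\int[P]_w GD w) * \int[P]_w forward_diff g (W w).
  rewrite -RintegralZl// -RintegralD//.
  - by apply: eq_Rintegral => w _; rewrite -mulrDl subrK.
  - have := integrableB measurableT iYdg (integrableZl measurableT (\int[P]_w GD w) idg).
    by congr (integrable _ _ _); apply/funext => w /=; rewrite mulrBl EFinB EFinM.
  - exact: (integrableZl measurableT (\int[P]_w GD w) idg).
have -> : (\int[P]_w GD w) * \int[P]_w forward_diff g (W w) =
    (sigma ^+ 2 + \int[P]_w (Rm w * X w)) * \int[P]_w forward_diff g (W w).
  by rewrite mean_GD.
lra.
Qed.

(** The first differences stay inside the integrals because the total variation bound inserts a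
    uniform estimate for them and the local bound a pointwise one. The factor [lam - sigma^2] pays
    for replacing the variance by the Poisson parameter, and [r * sigma] is Cauchy-Schwarz for
    [E R X]. *)
Lemma coupling_stein_bound (lam : R) (g : int -> R) (B : R) : 0 < B ->
  (forall k, `|g k| <= B) -> sigma ^+ 2 <= lam ->
  ((`|\int[P]_w (lam * forward_diff g (W w) - X w * g (W w))|)%:E <=
   ((lam - sigma ^+ 2 + r * sigma) * \int[P]_w `|forward_diff g (W w)| + B * r)%:E +
   \int[P]_w (Psi w * `|forward_diff g (W w)|)%:E +
   (B / 2)%:E * Upsilon)%E.
Proof.
move=> B0 gB slam.
have dgB k : `|forward_diff g k| <= 2 * B.
  by rewrite /forward_diff; have := gB (k + 1); have := gB k; rewrite !ler_norml; lra.
have mdg := measurable_RVint (forward_diff g).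
have mg := measurable_RVint g.
have idg : intble (fun w => forward_diff g (W w)).
  by apply: (@bounded_integrable _ _ _ _ _ _ (2 * B)).
have iXg : intble (fun w => X w * g (W w)).
  by apply: (integrable_mul_bounded intble_centered mg) => w; exact: gB.
have iRg : intble (fun w => Rm w * g (W w)).
  by apply: (integrable_mul_bounded intble_remainder mg) => w; exact: gB.
have iYm : intble (fun w => Y w - \int[P]_w GD w).
  exact: (integrableB measurableT intble_Y (intble_cst _)).
have iYdg : intble (fun w => (Y w - \int[P]_w GD w) * forward_diff g (W w)).
  by apply: (integrable_mul_bounded iYm mdg) => w; exact: dgB.
have PsiE : (\int[P]_w (Psi w * `|forward_diff g (W w)|)%:E =
    (\int[P]_w `|(Y w - \int[P]_w GD w) * forward_diff g (W w)|)%:E)%E.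
  rewrite -(intble_EFin (integrable_norm iYdg)); apply: eq_integral => w _.
  by rewrite /Psi fine_mean_GD /= normrM.
have := newton_rem_expectation_le sF2 KW F2GD intble_GD B0 gB.
rewrite -/Upsilon => hU; rewrite PsiE -EFinD.
apply: (le_trans _ (leeD2l _ hU)); rewrite -EFinD lee_fin.
rewrite RintegralB//; last exact: (integrableZl measurableT lam idg).
rewrite RintegralZl//.
have := coupling_expansion B0 gB.
set m1 := \int[P]_w forward_diff g (W w); set I1 := \int[P]_w (X w * _).
set I2 := \int[P]_w (_ * forward_diff g (W w)); set I3 := \int[P]_w (G w * _).
set I4 := \int[P]_w (Rm w * g (W w)) => e.
have -> : lam * m1 - I1 = (lam - sigma ^+ 2) * m1 - I2 -
    \int[P]_w (Rm w * X w) * m1 - I3 + I4 by lra.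
have h1 : `|m1| <= \int[P]_w `|forward_diff g (W w)| by exact: le_normr_Rintegral.
have h2 : `|I2| <= \int[P]_w `|(Y w - \int[P]_w GD w) * forward_diff g (W w)|.
  exact: le_normr_Rintegral.
have h4 : `|I4| <= B * r.
  apply: (le_trans (le_normr_Rintegral _ iRg)) => //.
  have iBR : intble (fun w => B * `|Rm w|).
    exact: (integrableZl measurableT B (integrable_norm intble_remainder)).
  apply: (@le_trans _ _ (\int[P]_w (B * `|Rm w|))).
    apply: le_Rintegral => //; first exact: integrable_norm.
    by move=> w _; rewrite normrM mulrC ler_wpM2r.
  rewrite RintegralZl//; last exact: integrable_norm intble_remainder.
  by rewrite ler_wpM2l ?(ltW B0)// mean_norm_le_sqrt.
have h5 : `|\int[P]_w (Rm w * X w) * m1| <= r * sigma * \int[P]_w `|forward_diff g (W w)|.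
  by rewrite normrM ler_pM// mean_remainder_centered.
have h6 : `|(lam - sigma ^+ 2) * m1| <= (lam - sigma ^+ 2) * \int[P]_w `|forward_diff g (W w)|.
  by rewrite normrM ger0_norm ?subr_ge0// ler_wpM2l// subr_ge0.
rewrite (le_trans (ler_normD _ _))// (le_trans (lerD (ler_normB _ _) (lexx _)))//.
have := ler_normB ((lam - sigma ^+ 2) * m1 - I2) (\int[P]_w (Rm w * X w) * m1).
have := ler_normB ((lam - sigma ^+ 2) * m1) I2.
lra.
Qed.

(** The shift lies [lam >= sigma^2] below the mean, so the indicator of [W < s] is at most
    [X^2 / sigma^4]. *)
Lemma mean_below_le (lam : R) (s : int) : sigma ^+ 2 <= lam -> s%:~R + lam = mu ->
  \int[P]_w ((W w < s)%R%:R : R) <= (sigma ^+ 2)^-1.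
Proof.
move=> slam slmu.
have s2 : 0 < sigma ^+ 2 by rewrite exprn_gt0.
have i1 : intble (fun w => (W w < s)%R%:R : R).
  apply: (@bounded_integrable _ _ _ _ _ _ 1) => // [|w].
    exact: (measurable_RVint (fun k => (k < s)%R%:R)).
  by case: (_ < _); rewrite ?normr1 ?normr0.
have i2 : intble (fun w => sigma ^- 4 * X w ^+ 2).
  exact: (integrableZl measurableT (sigma ^- 4) integrable_sqr_centered).
have -> : (sigma ^+ 2)^-1 = \int[P]_w (sigma ^- 4 * X w ^+ 2).
  rewrite RintegralZl//; last exact: integrable_sqr_centered.
  by rewrite Rintegral_sqr_centered; field; rewrite gt_eqF.
apply: le_Rintegral => // w _.
have [Ws|_] := boolP (W w < s)%R; last by rewrite mulr_ge0 ?invr_ge0 ?sqr_ge0// exprn_ge0// ltW.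
rewrite mulrC ler_pdivlMr ?exprn_gt0// mul1r (_ : sigma ^+ 4 = (sigma ^+ 2) ^+ 2); last by ring.
have Wle : (W w)%:~R <= s%:~R :> R by rewrite ler_int ltW.
have sX : sigma ^+ 2 <= - X w by rewrite /X; lra.
by rewrite -[X w ^+ 2]sqrrN ler_sqr ?nnegrE ?(ltW s2) ?(le_trans (ltW s2) sX).
Qed.

End Coupling.

(** * The Stein equation of the translated Poisson law *)

Section TranslatedStein.
Context {R : realType} (lam : R) (lam_gt0 : 0 < lam) (s : int) (A : set int).
Local Notation pA := (poisson_mass lam (translate s @^-1` A)).

Definition tstein (k : int) : R :=
  if k - s is Posz n then poisson_stein lam (translate s @^-1` A) n else 0.

Lemma tstein_shift (n : nat) : tstein (translate s n) = poisson_stein lam (translate s @^-1` A) n.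
Proof. by rewrite /tstein /translate addrK. Qed.

Lemma tstein_below k : k <= s -> tstein k = 0.
Proof.
by rewrite /tstein -subr_le0; case: (k - s) => [[|n]|n].
Qed.

Lemma int_shiftP (k : int) : s <= k -> exists n, k = translate s n.
Proof.
rewrite -subr_ge0 /translate; case e : (k - s) => [n|n]// _; exists n.
by rewrite -e subrK.
Qed.

(** For [k < s] both [k] and [k + 1] are at most [s], where the solution vanishes. The equation then
    misses [\1_A k - pA], of absolute value at most [1], which is charged to the event [W < s]. *)
Lemma tstein_eq k :
  lam * forward_diff tstein k - (k%:~R - (s%:~R + lam)) * tstein k =
  if s <= k then \1_A k - pA else 0.
Proof.
case: (leP s k) => [/int_shiftP[n ->]|ks]; last first.
  rewrite /forward_diff !tstein_below ?(ltW ks)//; first by rewrite subrr !mulr0 subrr.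
  by rewrite -ltzD1 ltrD2r.
have e : translate s n + 1 = translate s n.+1.
  by rewrite /translate -[n.+1]addn1 PoszD addrAC.
rewrite /forward_diff e !tstein_shift.
have -> : (\1_A (translate s n) : R) = \1_(translate s @^-1` A) n by [].
rewrite -(poisson_stein_eq lam_gt0) /translate intrD; ring.
Qed.

Lemma norm_tstein_le (C : R) k : 0 <= C ->
  (forall n, `|poisson_stein lam (translate s @^-1` A) n| <= C) -> `|tstein k| <= C.
Proof. by move=> C0 h; rewrite /tstein; case: (k - s) => [n|n]; rewrite ?normr0. Qed.

Lemma norm_diff_tstein_le k : `|forward_diff tstein k| <= lam^-1.
Proof.
rewrite /forward_diff; case: (leP s k) => [/int_shiftP[n ->]|ks].
  have -> : translate s n + 1 = translate s n.+1.
    by rewrite /translate -[n.+1]addn1 PoszD addrAC.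
  by rewrite !tstein_shift norm_diff_poisson_stein_le.
rewrite !tstein_below ?(ltW ks)//; first by rewrite subrr normr0 invr_ge0 ltW.
by rewrite -ltzD1 ltrD2r.
Qed.

Lemma norm_indic_poisson_mass_le k : `|\1_A k - pA| <= 1.
Proof.
have p0 : 0 <= pA by rewrite fine_ge0.
have p1 : pA <= 1.
  by rewrite /poisson_mass -lee_fin fineK ?fin_num_measure// probability_le1.
by rewrite indicE; case: (_ \in _); rewrite ler_norml /=; lra.
Qed.

End TranslatedStein.

Lemma ediv_EFin (R : realType) (x : \bar R) (y : R) : 0 < y ->
  (x / y%:E = x * (y^-1)%:E)%E.
Proof. by move=> y0; rewrite inver gt_eqF. Qed.

Section Distance.
Context d (T : measurableType d) (R : realType) (P : probability T R).
Context (W : {RV P >-> int}) (lam : R) (lam_gt0 : 0 < lam) (s : int) (A : set int).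
Local Notation pA := (poisson_mass lam (translate s @^-1` A)).
Local Notation g := (tstein lam s A).

Lemma distribution_poisson_mass_le :
  `|fine (P (W @^-1` A)) - pA| <=
  `|\int[P]_w (lam * forward_diff g (W w) - ((W w)%:~R - (s%:~R + lam)) * g (W w))| +
  \int[P]_w ((W w < s)%R%:R : R).
Proof.
have mW (f : int -> R) : measurable_fun setT (fun w => f (W w)) by exact: measurable_RVint.
pose f1 k : R := if s <= k then \1_A k - pA else 0.
pose f2 k : R := (k < s)%R%:R * (\1_A k - pA).
have b1 k : `|f1 k| <= 1.
  by rewrite /f1; case: ifP => _; rewrite ?norm_indic_poisson_mass_le ?normr0.
have b0 k : `|(k < s)%R%:R : R| <= 1 by case: (_ < _); rewrite ?normr1 ?normr0.
have b2 k : `|f2 k| <= 1.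
  by rewrite normrM mulr_ile1// norm_indic_poisson_mass_le.
have mA : measurable (W @^-1` A) by rewrite -[X in measurable X]setTI; exact: measurable_funPT.
have iA : P.-integrable setT (EFin \o (fun w => \1_(W @^-1` A) w : R)).
  by apply: integrable_indic.
have -> : fine (P (W @^-1` A)) - pA = \int[P]_w (f1 (W w)) + \int[P]_w (f2 (W w)).
  have i1 : P.-integrable setT (EFin \o (fun w => f1 (W w))).
    by apply: (@bounded_integrable _ _ _ _ _ _ 1).
  have i2 : P.-integrable setT (EFin \o (fun w => f2 (W w))).
    by apply: (@bounded_integrable _ _ _ _ _ _ 1).
  rewrite -RintegralD//.
  have -> : fine (P (W @^-1` A)) = \int[P]_w (\1_(W @^-1` A) w).
    by rewrite /Rintegral integral_indic// setIT.
  have {1}-> : pA = \int[P]_w (cst pA w).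
    by rewrite Rintegral_cst//= probability_setT mulr1.
  rewrite -RintegralB//; last exact: intble_cst.
  apply: eq_Rintegral => w _; rewrite /f1 /f2 /= leNgt.
  rewrite (_ : \1_(W @^-1` A) w = \1_A (W w))//.
  by case: (W w < s) => /=; ring.
rewrite (le_trans (ler_normD _ _))// lerD//.
  by rewrite le_eqVlt; apply/orP; left; apply/eqP; congr (`| _ |);
    apply: eq_Rintegral => w _; rewrite (tstein_eq lam_gt0).
apply: (le_trans (le_normr_Rintegral _ _)) => //.
  by apply: (@bounded_integrable _ _ _ _ _ _ 1).
apply: le_Rintegral => //.
- apply: integrable_norm; by apply: (@bounded_integrable _ _ _ _ _ _ 1).
- by apply: (@bounded_integrable _ _ _ _ _ _ 1) => //; exact: (mW (fun k => (k < s)%R%:R)).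
- move=> w _; rewrite normrM ger0_norm// ler_piMr//.
  exact: norm_indic_poisson_mass_le.
Qed.

End Distance.

(** * The two distance bounds *)

Theorem theorem2p1 (R : realType) (d : measure_display) (T : measurableType d)
    (P : probability T R) (mu sigma : R)
    (W W' : {RV P >-> int}) (G Rm : {RV P >-> R})
    (F1 F2 : set (set T)) (Y : T -> R) (K : T -> probability int R) :
  approx_stein_coupling mu W W' G Rm ->
  0 < sigma ->
  ('V_P[fun w => (W w)%:~R] = (sigma ^+ 2)%:E)%E ->
  let D : T -> int := fun w => W' w - W w in
  is_sub_sigma_algebra F1 -> is_sub_sigma_algebra F2 ->
  sub_measurable F1 W ->
  sub_measurable F2 (fun w => (G w, D w)) ->
  let GD : T -> R := fun w => G w * (D w)%:~R in
  cond_expectation P F1 GD Y ->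
  cond_law P F2 W K ->
  let Psi : T -> R := fun w => `|Y w - fine ('E_P[GD])%E| in
  let Upsilon : \bar R :=
    (\int[P]_w (`|G w * (D w)%:~R * ((D w)%:~R - 1)|%:E
                * smoothness 2 (K w)))%E in
  let TP : probability int R := translated_poisson mu (sigma ^+ 2) in
  (dTV (distribution P W) TP <=
     'E_P[Psi] / (sigma ^+ 2)%:E
     + 2%:E * sqrte 'E_P[fun w => (Rm w ^+ 2)%R] / sigma%:E
     + 2%:E * (Upsilon + 1) / sigma%:E)%E
  /\
  (dloc (distribution P W) TP <=
     'E_P[Psi] / (sigma ^+ 3 * Num.sqrt (2 * expR 1))%:E
     + 'E_P[fun w => (Psi w * `|(W w)%:~R - mu|)%R] / (sigma ^+ 4)%:E
     + ereal_sup [set ('E_P[fun w => (Psi w * \1_(W @^-1` [set a]) w)%R]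
                        / (sigma ^+ 2)%:E)%E | a in [set: int]]
     + sqrte 'E_P[fun w => (Rm w ^+ 2)%R] / (sigma ^+ 2)%:E
       * (2%:E + ((Num.sqrt (2 * expR 1))^-1)%:E
          + sigma%:E * ereal_sup [set P (W @^-1` [set a]) | a in [set: int]])
     + 2%:E * (Upsilon + 1) / (sigma ^+ 2)%:E)%E.
Proof.
move=> cpl s0 varW D sF1 sF2 F1W F2GD GD YGD KW Psi Upsilon TP.
set s := tp_shift mu (sigma ^+ 2).
set lam := sigma ^+ 2 + tp_gamma mu (sigma ^+ 2).
have s20 : 0 < sigma ^+ 2 by rewrite exprn_gt0.
have slmu : s%:~R + lam = mu by rewrite /lam /tp_gamma /s /tp_shift; lra.
have /andP[lamge lam1] : sigma ^+ 2 <= lam <= sigma ^+ 2 + 1.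
  have := floor_itv (mu - sigma ^+ 2); rewrite intrD /lam /tp_gamma => /andP[? ?].
  by apply/andP; split; lra.
have lam0 : 0 < lam by exact: lt_le_trans lamge.
have TPE A : TP A = (poisson_mass lam (translate s @^-1` A))%:E.
  by rewrite /poisson_mass fineK// fin_num_measure.
have mWA A : measurable (W @^-1` A).
  by rewrite -[X in measurable X]setTI; exact: measurable_funPT.
have WE A : (distribution P W : probability int R) A = (fine (P (W @^-1` A)))%:E.
  by rewrite fineK// fin_num_measure.
have iPsi : P.-integrable setT (EFin \o Psi) by exact: (intble_Psi YGD).
have mPsi := intble_measurable iPsi.
have Psi0 w : 0 <= Psi w by exact: normr_ge0.
set ep := \int[P]_w Psi w.
have EPsi : ('E_P[Psi] = ep%:E)%E by rewrite unlock intble_EFin.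
have ep0 : 0 <= ep by exact: Rintegral_ge0.
have U0 : (0 <= Upsilon)%E.
  by apply: integral_ge0 => w _; rewrite mule_ge0// smoothness2_ge0.
have Un1 : (0 <= 2%:E * (Upsilon + 1))%E by rewrite mule_ge0// adde_ge0.
set x := sqrte _.
have x0 : (0 <= x)%E by exact: sqrte_ge0.
set v := ('E_P[fun w => (Psi w * `|(W w)%:~R - mu|)%R])%E.
have v0 : (0 <= v)%E.
  by rewrite /v unlock; apply: integral_ge0 => w _; rewrite lee_fin mulr_ge0.
set Q := ereal_sup _.
set p := ereal_sup _.
set kappa := (Num.sqrt (2 * expR 1))^-1.
have kappa0 : 0 < kappa by rewrite invr_gt0 sqrtr_gt0 mulr_gt0// expR_gt0.
pose pW a : R := fine (P (W @^-1` [set a])).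
have pWp a : ((pW a)%:E <= p)%E.
  by rewrite /pW fineK ?fin_num_measure//; apply: ereal_sup_ubound; exists a.
pose q a : R := \int[P]_w (Psi w * \1_(W @^-1` [set a]) w).
have iq a : P.-integrable setT (EFin \o (fun w => Psi w * \1_(W @^-1` [set a]) w)).
  apply: (integrable_mul_bounded (B := 1) iPsi) => [|w].
    exact: measurable_indic.
  by rewrite indicE; case: (_ \in _); rewrite ?normr1 ?normr0.
have qQ a : ((q a / sigma ^+ 2)%:E <= Q)%E.
  rewrite EFinM -intble_EFin// -ediv_EFin//; apply: ereal_sup_ubound.
  by exists a => //; rewrite unlock.
have p0 : (0 <= p)%E by apply: (le_trans _ (pWp 0)); rewrite lee_fin fine_ge0.
have Q0 : (0 <= Q)%E.
  apply: (le_trans _ (qQ 0)); rewrite lee_fin divr_ge0// ?(ltW s20)//.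
  by apply: Rintegral_ge0 => w _; rewrite mulr_ge0.
have e30 : 0 < sigma ^+ 3 * Num.sqrt (2 * expR 1).
  by rewrite mulr_gt0 ?exprn_gt0// sqrtr_gt0 mulr_gt0// expR_gt0.
have s40 : 0 < sigma ^+ 4 by rewrite exprn_gt0.
rewrite EPsi !ediv_EFin//.
have div0 (z : \bar R) (y : R) : 0 < y -> (0 <= z)%E -> (0 <= z * (y^-1)%:E)%E.
  by move=> y0 z0; rewrite mule_ge0// lee_fin invr_ge0 ltW.
have nN (z : \bar R) : (0 <= z)%E -> z != -oo%E by case: z.
have inv0 (y : R) : 0 < y -> (0 < (y^-1)%:E)%E by move=> y0; rewrite lte_fin invr_gt0.
have a0 : (0 <= ep%:E * ((sigma ^+ 3 * Num.sqrt (2 * expR 1))^-1)%:E +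
    v * ((sigma ^+ 4)^-1)%:E + Q)%E.
  by rewrite !adde_ge0// div0.
have pf0 : (0 < 2%:E + kappa%:E + sigma%:E * p)%E.
  apply: (@lt_le_trans _ _ (2%:E + kappa%:E)%E); first by rewrite -EFinD lte_fin addr_gt0.
  by rewrite leeDl// mule_ge0// lee_fin ltW.
have b0 : (0 <= x * ((sigma ^+ 2)^-1)%:E * (2%:E + kappa%:E + sigma%:E * p))%E.
  by apply: mule_ge0; [exact: div0|exact: ltW].
(* An infinite [x] or [Upsilon] makes both right-hand sides infinite: the other summands are
   nonnegative, and the factor multiplying [x] in the local bound is strictly positive by [pf0]. *)
have [xy|xfin] := eqVneq x +oo%E.
  rewrite xy; split.
    rewrite gt0_muley ?lte_fin// gt0_mulye ?inv0// addey ?nN ?div0//.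
    by rewrite addye ?leey// nN// div0.
  rewrite gt0_mulye ?inv0// gt0_mulye// addey ?nN//.
  by rewrite addye ?leey// nN// div0.
have [Uy|Ufin] := eqVneq Upsilon +oo%E.
  rewrite Uy addye// gt0_muley ?lte_fin//.
  rewrite !gt0_mulye ?inv0// !addey ?leey// nN//.
    by rewrite adde_ge0.
  by rewrite adde_ge0 ?div0// mule_ge0.
have {}x0 : x \is a fin_num by rewrite ge0_fin_numE// lt_neqAle xfin leey.
have UE : Upsilon = (fine Upsilon)%:E by rewrite fineK// ge0_fin_numE// lt_neqAle Ufin leey.
set u := fine Upsilon in UE.
have u0 : 0 <= u by rewrite fine_ge0.
have iR2 : P.-integrable setT (EFin \o (fun w => Rm w ^+ 2)).
  apply/integrableP; split.
    by apply/measurable_EFinP; apply: measurable_funX.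
  under eq_integral => w _ do rewrite /= ger0_norm ?sqr_ge0//.
  rewrite ltey; apply: contra_neq xfin => e; rewrite /x unlock e //.
pose r : R := Num.sqrt (\int[P]_w Rm w ^+ 2).
have xE : x = r%:E by rewrite /x unlock intble_EFin.
have r0 : 0 <= r by exact: sqrtr_ge0.
have core := coupling_stein_bound cpl s0 varW sF1 sF2 F1W F2GD YGD KW iR2.
pose g A := tstein lam s A.
pose M A : R := \int[P]_w `|forward_diff (g A) (W w)|.
pose J A : R := \int[P]_w (Psi w * `|forward_diff (g A) (W w)|).
have mdg A : measurable_fun setT (fun w => `|forward_diff (g A) (W w)|).
  exact: (measurable_RVint W (fun k => `|forward_diff (g A) k|)).
have laminv : lam^-1 <= (sigma ^+ 2)^-1 by rewrite lef_pV2.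
have dgle A k : `|forward_diff (g A) k| <= (sigma ^+ 2)^-1.
  exact: le_trans (norm_diff_tstein_le lam0 s A k) laminv.
have ndgle A k : `| `|forward_diff (g A) k| | <= (sigma ^+ 2)^-1 by rewrite normr_id.
have iJ A : P.-integrable setT (EFin \o (fun w => Psi w * `|forward_diff (g A) (W w)|)).
  by apply: (integrable_mul_bounded iPsi (mdg A)) => w; exact: ndgle.
have M0 A : 0 <= M A by exact: Rintegral_ge0.
have MleC A : M A <= (sigma ^+ 2)^-1.
  rewrite -[leLHS](ger0_norm (M0 A)).
  exact: (@norm_Rintegral_le _ _ _ P _ _ (mdg A) (fun w => ndgle A (W w))).
have step A (B : R) : 0 < B -> (forall n, `|poisson_stein lam (translate s @^-1` A) n| <= B) ->
    `|fine (P (W @^-1` A)) - poisson_mass lam (translate s @^-1` A)| <=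
    (lam - sigma ^+ 2 + r * sigma) * M A + B * r + J A + B / 2 * u + (sigma ^+ 2)^-1.
  move=> B0 gB; apply: (le_trans (distribution_poisson_mass_le W lam0 s A)).
  apply: lerD; last exact: (mean_below_le cpl s0 varW lamge slmu).
  rewrite slmu -lee_fin.
  have gA k : `|g A k| <= B by exact: norm_tstein_le (ltW B0) gB.
  have := core lam (g A) B B0 gA lamge.
  by rewrite -/Upsilon UE -/Psi (intble_EFin (iJ A)).
rewrite xE UE; split.
  apply: ge_ereal_sup => _ [A _ <-].
  rewrite WE TPE -EFinB.
  rewrite -[leRHS]/((ep * (sigma ^+ 2)^-1 + 2 * r * sigma^-1 + 2 * (u + 1) * sigma^-1)%:E).
  rewrite lee_fin.
  (* For [sigma < 1] the term [2 / sigma] alone exceeds the distance, which is at most [1].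
     Otherwise [1 / sigma^2 <= 1 / sigma], which absorbs the two constant errors. *)
  have [sigma1|sigma1] := ltP sigma 1.
    have d1 : `|fine (P (W @^-1` A)) - poisson_mass lam (translate s @^-1` A)| <= 1.
      have P0 : 0 <= fine (P (W @^-1` A)) by rewrite fine_ge0.
      have P1 : fine (P (W @^-1` A)) <= 1.
        by rewrite -lee_fin fineK ?fin_num_measure// probability_le1.
      have p0' : 0 <= poisson_mass lam (translate s @^-1` A) by rewrite fine_ge0.
      have p1' : poisson_mass lam (translate s @^-1` A) <= 1.
        by rewrite /poisson_mass -lee_fin fineK ?fin_num_measure// probability_le1.
      rewrite ler_norml; lra.
    have i1 : 1 <= sigma^-1 by rewrite invf_ge1// ltW.
    have : 0 <= ep * (sigma ^+ 2)^-1 by rewrite mulr_ge0// invr_ge0 ltW.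
    have : 0 <= 2 * r * sigma^-1 by rewrite !mulr_ge0// invr_ge0 ltW.
    have : 0 <= u * sigma^-1 by rewrite mulr_ge0// invr_ge0 ltW.
    lra.
  have B0 : 0 < sigma^-1 by rewrite invr_gt0.
  have gB n : `|poisson_stein lam (translate s @^-1` A) n| <= sigma^-1.
    apply: (le_trans (norm_poisson_stein_le lam0 _ _)).
    rewrite lef_pV2 ?posrE ?sqrtr_gt0// -[leLHS]gtr0_norm// -sqrtr_sqr.
    by rewrite ler_sqrt// ltW.
  have JleC : J A <= ep * (sigma ^+ 2)^-1.
    rewrite -RintegralZr//; apply: le_Rintegral => //.
      exact: (integrableZr measurableT (sigma ^+ 2)^-1 iPsi).
    by move=> w _; rewrite ler_wpM2l.
  have := step A _ B0 gB.
  (* [r * sigma * M A] and [B * r] contribute [r / sigma] each, hence the factor [2] at the root of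
     [E R^2]. *)
  have h1 : (lam - sigma ^+ 2 + r * sigma) * M A <= (1 + r * sigma) * (sigma ^+ 2)^-1.
    apply: ler_pM => //; last by rewrite lerD2r; lra.
    by rewrite addr_ge0 ?subr_ge0// mulr_ge0// ltW.
  have h2 : r * sigma * (sigma ^+ 2)^-1 = r * sigma^-1 by field; rewrite gt_eqF.
  have h3 : (sigma ^+ 2)^-1 <= sigma^-1.
    by rewrite lef_pV2// expr2 ler_peMl// ltW.
  have h4 : 0 <= u * sigma^-1 by rewrite mulr_ge0// ltW.
  lra.
apply: ge_ereal_sup => _ [a _ <-].
rewrite WE TPE -EFinB.
(* Integrability of [Psi] does not bound [E Psi |W - mu|]; if that is infinite, so is the right-hand
   side. *)
have [vy|vfin] := eqVneq v +oo%E.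
  have rest0 : (0 <= r%:E * ((sigma ^+ 2)^-1)%:E * (2%:E + kappa%:E + sigma%:E * p))%E.
    by rewrite -xE.
  have c0 : (0 <= 2%:E * (u%:E + 1) * ((sigma ^+ 2)^-1)%:E)%E by rewrite -UE; exact: div0.
  rewrite vy gt0_mulye ?inv0// addey//.
  by rewrite (addye (nN _ Q0)) (addye (nN _ rest0)) (addye (nN _ c0)) leey.
have vE : v = (fine v)%:E by rewrite fineK// ge0_fin_numE// lt_neqAle vfin leey.
have vr0 : 0 <= fine v by rewrite fine_ge0.
apply: (@le_trans _ _ (ep%:E * ((sigma ^+ 3 * Num.sqrt (2 * expR 1))^-1)%:E +
    (fine v)%:E * ((sigma ^+ 4)^-1)%:E + (q a / sigma ^+ 2)%:E +
    r%:E * ((sigma ^+ 2)^-1)%:E * (2%:E + kappa%:E + sigma%:E * (pW a)%:E) +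
    2%:E * (u%:E + 1) * ((sigma ^+ 2)^-1)%:E)%E); last first.
  rewrite vE; apply: leeD; last exact: lexx.
  apply: leeD; first by apply: leeD; [exact: lexx|exact: qQ].
  apply: lee_wpmul2l; first by rewrite lee_fin mulr_ge0// invr_ge0 ltW.
  apply: leeD; first exact: lexx.
  by apply: lee_wpmul2l; rewrite ?lee_fin ?(ltW s0)//; exact: pWp.
rewrite -[leRHS]/((ep * (sigma ^+ 3 * Num.sqrt (2 * expR 1))^-1 + fine v * (sigma ^+ 4)^-1
  + q a / sigma ^+ 2 + r * (sigma ^+ 2)^-1 * (2 + kappa + sigma * pW a)
  + 2 * (u + 1) * (sigma ^+ 2)^-1)%:E) lee_fin.
have q0 : 0 <= q a by apply: Rintegral_ge0 => w _; rewrite mulr_ge0.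
have pW0 : 0 <= pW a by rewrite fine_ge0.
have kE : (sigma ^+ 3 * Num.sqrt (2 * expR 1))^-1 = kappa / sigma ^+ 3.
  by rewrite invfM mulrC.
(* Below the shift the translated Poisson law has no mass, and [P(W = a)] is at most [P(W < s)]. *)
have [as_|sa] := ltP a s.
  have A0 : translate s @^-1` [set a] = set0.
    rewrite -subset0 => n /= na; move: as_; rewrite -na /translate.
    by rewrite -subr_lt0 addrK.
  have pWs : pW a <= (sigma ^+ 2)^-1.
    apply: (le_trans _ (mean_below_le cpl s0 varW lamge slmu)).
    have -> : pW a = \int[P]_w (\1_(W @^-1` [set a]) w).
      by rewrite /Rintegral integral_indic// setIT.
    apply: le_Rintegral => //; first exact: integrable_indic.
      apply: (@bounded_integrable _ _ _ _ _ _ 1) => // [|w].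
        exact: (measurable_RVint W (fun k => (k < s)%R%:R)).
      by case: (_ < _); rewrite ?normr1 ?normr0.
    move=> w _; rewrite indicE; have [->|Wa] := eqVneq (W w) a.
      by rewrite as_ ler_nat leq_b1.
    rewrite memNset ?ler0n//= => e; move: Wa; rewrite e eqxx//.
  rewrite A0 /poisson_mass measure0 subr0 ger0_norm//.
  have h1 : 0 <= ep * (sigma ^+ 3 * Num.sqrt (2 * expR 1))^-1.
    by rewrite mulr_ge0// invr_ge0 ltW.
  have h2 : 0 <= fine v * (sigma ^+ 4)^-1 by rewrite mulr_ge0// invr_ge0 ltW.
  have h3 : 0 <= q a / sigma ^+ 2 by rewrite divr_ge0// ltW.
  have h4 : 0 <= r * (sigma ^+ 2)^-1 * (2 + kappa + sigma * pW a).
    by rewrite !mulr_ge0 ?addr_ge0 ?mulr_ge0 ?invr_ge0 ?(ltW kappa0) ?(ltW s20) ?(ltW s0).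
  have h5 : 0 <= u * (sigma ^+ 2)^-1 by rewrite mulr_ge0// invr_ge0 ltW.
  have h6 : 0 <= (sigma ^+ 2)^-1 by rewrite invr_ge0 ltW.
  by rewrite -/(pW a); lra.
have [n an] := int_shiftP sa.
have A1 : translate s @^-1` [set a] = [set n].
  apply/seteqP; split => [m /= ma|m /= ->]; last by rewrite an.
  by move: ma; rewrite an /translate => /addIr [].
have B0 : 0 < (sigma ^+ 2)^-1 by rewrite invr_gt0.
have gB m : `|poisson_stein lam (translate s @^-1` [set a]) m| <= (sigma ^+ 2)^-1.
  by rewrite A1; exact: le_trans (norm_poisson_stein1_le lam0 _ _) laminv.
have := step [set a] _ B0 gB.
(* The origin of [1 / sqrt (2 e)] in the local bound: the largest Poisson weight, with
   [lam >= sigma^2]. *)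
have pis : poisson_mass lam (translate s @^-1` [set a]) <= kappa / sigma.
  rewrite A1 poisson_mass1//; apply: (le_trans (poisson_pmf_le n lam0)).
  rewrite /kappa -invfM lef_pV2 ?posrE ?mulr_gt0 ?sqrtr_gt0 ?mulr_gt0 ?expR_gt0//.
  rewrite [leRHS]sqrtrM ?mulr_ge0 ?expR_ge0// ler_wpM2l ?sqrtr_ge0//.
  by rewrite -[leLHS]gtr0_norm// -sqrtr_sqr ler_sqrt// ltW.
(* Solved for [lam * Delta g], the Stein equation leaves the indicator, the Poisson weight and
   [(k - mu) * g k]. Integrated against [Psi], these become the three [Psi] terms of the local
   bound. *)
have dgp k : `|forward_diff (g [set a]) k| <=
    (\1_[set a] k + kappa / sigma + `|k%:~R - mu| / sigma ^+ 2) / sigma ^+ 2.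
  have gk : `|g [set a] k| <= (sigma ^+ 2)^-1 by exact: norm_tstein_le (ltW B0) gB.
  have := tstein_eq lam0 s [set a] k; rewrite slmu => e.
  have le : `|lam * forward_diff (g [set a]) k| <=
      \1_[set a] k + kappa / sigma + `|k%:~R - mu| / sigma ^+ 2.
    rewrite (_ : lam * _ = (if s <= k then \1_[set a] k -
      poisson_mass lam (translate s @^-1` [set a]) else 0) + (k%:~R - mu) * g [set a] k); last first.
      by rewrite -e subrK.
    apply: (le_trans (ler_normD _ _)); apply: lerD; last by rewrite normrM ler_wpM2l.
    have i0 : 0 <= (\1_[set a] k : R) by rewrite indicE.
    have ks0 : 0 <= kappa / sigma by rewrite divr_ge0 ?ltW.
    case: ifP => _; last by rewrite normr0 addr_ge0.
    apply: (le_trans (ler_normB _ _)); rewrite ger0_norm// lerD2l ger0_norm//.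
    by rewrite fine_ge0.
  rewrite ler_pdivlMr//; apply: (le_trans _ le).
  by rewrite normrM (gtr0_norm lam0) mulrC ler_wpM2r.
(* Used with [Z = 1] for [M] and with [Z = Psi] for [J]. *)
have weighted (Z : T -> R) : (forall w, 0 <= Z w) -> P.-integrable setT (EFin \o Z) ->
    P.-integrable setT (EFin \o (fun w => Z w * \1_(W @^-1` [set a]) w)) ->
    P.-integrable setT (EFin \o (fun w => Z w * `|(W w)%:~R - mu|)) ->
    \int[P]_w (Z w * `|forward_diff (g [set a]) (W w)|) <=
    (\int[P]_w (Z w * \1_(W @^-1` [set a]) w) + kappa / sigma * \int[P]_w Z w +
     (\int[P]_w (Z w * `|(W w)%:~R - mu|)) / sigma ^+ 2) / sigma ^+ 2.
  move=> Z0 iZ i1 i3.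
  have i2 := integrableZl measurableT (kappa / sigma) iZ.
  have i3' := integrableZr measurableT (sigma ^+ 2)^-1 i3.
  have i12 := integrableD measurableT i1 i2.
  have i123 := integrableD measurableT i12 i3'.
  have i := integrableZr measurableT (sigma ^+ 2)^-1 i123.
  rewrite -(RintegralZl (kappa / sigma) measurableT iZ).
  rewrite -(RintegralZr (sigma ^+ 2)^-1 measurableT i3).
  rewrite -(RintegralD measurableT i1 i2) -(RintegralD measurableT i12 i3').
  rewrite -(RintegralZr (sigma ^+ 2)^-1 measurableT i123).
  apply: le_Rintegral => //.
    by apply: (integrable_mul_bounded iZ (mdg _)) => w; exact: ndgle.
  move=> w _; have := ler_wpM2l (Z0 w) (dgp (W w)).
  have -> : (\1_[set a] (W w) : R) = \1_(W @^-1` [set a]) w by [].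
  by move=> /le_trans; apply; rewrite le_eqVlt; apply/orP; left; apply/eqP; ring.
have iX := integrable_norm (intble_centered cpl varW).
have Mle : M [set a] <= (pW a + kappa / sigma + sigma / sigma ^+ 2) / sigma ^+ 2.
  have i1 : P.-integrable setT (EFin \o (fun=> 1 : R)) by exact: intble_cst.
  have e1 : (fun w => 1 * \1_(W @^-1` [set a]) w) = (\1_(W @^-1` [set a]) : T -> R).
    by apply/funext => w; rewrite mul1r.
  have e2 : (fun w => 1 * `|(W w)%:~R - mu|) = (fun w => `|(W w)%:~R - mu|).
    by apply/funext => w; rewrite mul1r.
  have e3 : (fun w => 1 * `|forward_diff (g [set a]) (W w)|) =
      (fun w => `|forward_diff (g [set a]) (W w)|).
    by apply/funext => w; rewrite mul1r.
  have := weighted (fun=> 1) (fun=> ler01) i1; rewrite e1 e2 e3.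
  move=> /(_ (integrable_indic P (mWA [set a])) iX) /le_trans; apply.
  rewrite ler_wpM2r ?invr_ge0 ?(ltW s20)//.
  apply: lerD.
    rewrite Rintegral_cst//= probability_setT !mulr1 lerD2r.
    by rewrite /Rintegral integral_indic// setIT.
  rewrite ler_wpM2r ?invr_ge0 ?(ltW s20)//.
  exact: (mean_norm_centered cpl s0 varW).
have Jle : J [set a] <= (q a + kappa / sigma * ep + fine v / sigma ^+ 2) / sigma ^+ 2.
  have vR : fine v = \int[P]_w (Psi w * `|(W w)%:~R - mu|) by rewrite /v unlock.
  rewrite vR; apply: weighted => //.
  apply/integrableP; split.
    apply/measurable_EFinP; apply: measurable_funM => //.
    exact: (measurable_RVint W (fun k => `|k%:~R - mu|)).
  under eq_integral => w _ do rewrite /= ger0_norm ?mulr_ge0//.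
  by rewrite ltey; move: vfin; rewrite /v unlock.
(* For the variance mismatch the uniform bound on [Delta g] suffices; together with the Chebyshev
   term it gives [2 / sigma^2]. *)
have h1 : (lam - sigma ^+ 2) * M [set a] <= 1 * (sigma ^+ 2)^-1.
  by apply: ler_pM => //; lra.
have h2 := ler_wpM2l (mulr_ge0 r0 (ltW s0)) Mle.
have h3 : 0 <= u * (sigma ^+ 2)^-1 by rewrite mulr_ge0// ltW.
rewrite kE.
(* The [1] on the right comes from [E |W - mu| <= sigma]; the term [B * r = r / sigma^2] raises it
   to the [2] of the statement. *)
have h4 : r * sigma * ((pW a + kappa / sigma + sigma / sigma ^+ 2) / sigma ^+ 2) =
  r * (sigma ^+ 2)^-1 * (1 + kappa + sigma * pW a) by field; rewrite gt_eqF.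
have h5 : (q a + kappa / sigma * ep + fine v / sigma ^+ 2) / sigma ^+ 2 =
   q a / sigma ^+ 2 + ep * (kappa / sigma ^+ 3) + fine v * (sigma ^+ 4)^-1.
  by field; rewrite gt_eqF.
lra.
Qed.
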